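(* Let $U \subseteq \mathbb{R}^n$ be open, let $f: U \to \mathbb{R}^n$ be a $C^1$ vector field, and let $K$ be a compact subset of $U$. For a Riemannian metric $G$ on $U$ and $x \in U$ put $$\lambda_G(x) = \max\left\{ w^{\mathrm T}\left(G(x)J(x) + \tfrac12 \dot G(x)\right) w \;:\; w\in\mathbb{R}^n,\ w^{\mathrm T}G(x)w = 1,\ w^{\mathrm T}G(x)f(x) = 0\right\},$$ $$\lambda'_G(x) = \max\left\{ w^{\mathrm T}\left(J(x)G(x) - \tfrac12 \dot G(x)\right) w \;:\; w\in\mathbb{R}^n,\ w^{\mathrm T}w = 1,\ w^{\mathrm T}f(x) = 0\right\}.$$ Then the following three conditions are equivalent: 1. There are $c>0$ and a Riemannian metric $G$ on $U$ such that $\lambda_G(x) \le -c$ for all $x\in K$. 2. There are $c>0$ and a Riemannian metric $G$ on $U$ such that $\lambda'_G(x)\le -c$ for all $x\in K$. 3. There are $c'>0$ and a Riemannian metric $G$ on $U$ with polynomial entries such that $\lambda'_G(x)\le -c'$ for all $x\in K$.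
   Context: $J(x) = \frac{\partial f}{\partial x}(x)$ is the Jacobian matrix of $f$ at $x$. A Riemannian metric on $U$ is identified with its metric tensor $G=[g_{kl}]$, i.e. a $C^1$ map from $U$ to the symmetric $n\times n$ real matrices with $G(x)$ positive definite for every $x\in U$. $\dot G$ denotes the orbital derivative of $G$ along $f$: $\dot G(x) = \left[\sum_{j=1}^n f_j(x)\,\frac{\partial g_{kl}}{\partial x_j}(x)\right]_{k,l}$. A maximum over the empty set is read as $-\infty$ (this can only occur when $n=1$). *)

(* Defs.v *)
From HB Require Import structures.
From mathcomp Require Import all_boot all_order all_algebra.
From mathcomp Require Import all_classical all_reals all_analysis.
From mathcomp Require mpoly.

Set Implicit Arguments.
Unset Strict Implicit.
Unset Printing Implicit Defensive.

Import Order.TTheory GRing.Theory Num.Theory.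
Import numFieldNormedType.Exports.

Local Open Scope classical_set_scope.
Local Open Scope ring_scope.

(* Vectors of R^n are row vectors ['rV[R]_n]: the scalar u^T A v on columns
   is here the entry of u *m A *m v^T. Functions on an open set U are total
   functions of which only the values on U matter. *)

Section RiemannianMetric.
Context {R : realType} {n : nat}.

Definition bform (A : 'M[R]_n) (u v : 'rV[R]_n) : R := (u *m A *m v^T) 0 0.

Definition symmetric_mx (A : 'M[R]_n) : Prop := A^T = A.

Definition posdef_mx (A : 'M[R]_n) : Prop :=
  forall w : 'rV[R]_n, w != 0 -> 0 < bform A w w.

Definition C1_on {V : normedModType R} (U : set 'rV[R]_n)
    (g : 'rV[R]_n -> V) : Prop :=
  forall x, U x ->
    differentiable g x /\ forall v, {for x, continuous (fun y => 'D_v g y)}.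

Definition riemannian_metric (U : set 'rV[R]_n) (G : 'rV[R]_n -> 'M[R]_n) :=
  C1_on U G /\ forall x, U x -> symmetric_mx (G x) /\ posdef_mx (G x).

Definition polynomial_entries (U : set 'rV[R]_n) (G : 'rV[R]_n -> 'M[R]_n) :=
  exists P : 'I_n -> 'I_n -> mpoly.mpoly n R,
    forall x, U x -> forall k l,
      G x k l = mpoly.meval (fun i : 'I_n => x 0 i) (P k l).

(* [jacobian] acts on row vectors from the right, so its (i, j) entry is
   the derivative of f_j along x_i. *)
Definition Jmx (f : 'rV[R]_n -> 'rV[R]_n) (x : 'rV[R]_n) : 'M[R]_n :=
  (jacobian f x)^T.

Definition orbital_derivative (f : 'rV[R]_n -> 'rV[R]_n)
    (G : 'rV[R]_n -> 'M[R]_n) (x : 'rV[R]_n) : 'M[R]_n :=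
  \matrix_(k, l) \sum_(j < n) f x 0 j * 'D_(delta_mx 0 j) (fun y => G y k l) x.

(* In the two definitions below [ereal_sup] is -oo on the empty set, and is a
   maximum otherwise: see [lambda_attained] and [lambda'_attained]. *)
Definition lambda (f : 'rV[R]_n -> 'rV[R]_n) (G : 'rV[R]_n -> 'M[R]_n)
    (x : 'rV[R]_n) : \bar R :=
  ereal_sup
    [set (bform (G x *m Jmx f x + 2^-1 *: orbital_derivative f G x) w w)%:E
    | w in [set w : 'rV[R]_n | bform (G x) w w = 1 /\ bform (G x) w (f x) = 0]].

Definition lambda' (f : 'rV[R]_n -> 'rV[R]_n) (G : 'rV[R]_n -> 'M[R]_n)
    (x : 'rV[R]_n) : \bar R :=
  ereal_sup
    [set (bform (Jmx f x *m G x - 2^-1 *: orbital_derivative f G x) w w)%:E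
    | w in [set w : 'rV[R]_n | (w *m w^T) 0 0 = 1 /\ (w *m (f x)^T) 0 0 = 0]].

Lemma continuous_sumr (F : 'I_n -> 'rV[R]_n -> R) :
  (forall i, continuous (F i)) -> continuous (fun w => \sum_i F i w).
Proof.
move=> Fc; apply: (@continuous_big R^o _ +%R 0) => [|i _]; last exact: Fc.
by move=> z; apply: cvgD; [exact: cvg_fst | exact: cvg_snd].
Qed.

Lemma continuous_bforml (A : 'M[R]_n) (v : 'rV[R]_n) :
  continuous (fun w => bform A w v).
Proof.
have -> : (fun w => bform A w v) =
   (fun w : 'rV[R]_n => \sum_i w 0 i * (A *m v^T) i 0).
  by apply/funext => w; rewrite /bform -mulmxA mxE.
apply: continuous_sumr => i w.
by apply: continuousM; [exact: coord_continuous | exact: cst_continuous].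
Qed.

Lemma continuous_bformd (A : 'M[R]_n) : continuous (fun w => bform A w w).
Proof.
have -> : (fun w => bform A w w) =
   (fun w : 'rV[R]_n => \sum_i bform A w (delta_mx 0 i) * w 0 i).
  apply/funext => w; rewrite /bform [LHS]mxE; apply: eq_bigr => i _.
  by rewrite trmx_delta -colE !mxE.
apply: continuous_sumr => i w.
apply: (@continuousM _ _ (fun w => bform A w (delta_mx 0 i))).
  exact: continuous_bforml.
exact: coord_continuous.
Qed.

Lemma bformZ (A : 'M[R]_n) a (w : 'rV[R]_n) :
  bform A (a *: w) (a *: w) = a ^+ 2 * bform A w w.
Proof. by rewrite /bform linearZ /= -!scalemxAl -!scalemxAr !mxE expr2 mulrA. Qed.

Lemma posdef_mx1 : posdef_mx (1%:M : 'M[R]_n).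
Proof.
move=> w w0; rewrite /bform mulmx1 mxE lt_def.
rewrite sumr_ge0 ?andbT => [|i _]; last by rewrite mxE -expr2 sqr_ge0.
apply: contra_neq w0 => /eqP; rewrite psumr_eq0 => [/allP w0|i _]; last first.
  by rewrite mxE -expr2 sqr_ge0.
apply/rowP => i; have := w0 i (mem_index_enum _).
by rewrite !mxE /= mulf_eq0 orbb => /eqP.
Qed.

Lemma posdef_coercive (A : 'M[R]_n) : posdef_mx A ->
  exists2 m : R, 0 < m & forall w, m * `|w| ^+ 2 <= bform A w w.
Proof.
move=> Apos; pose S := [set w : 'rV[R]_n | `|w| = 1].
have scale w : w != 0 -> S (`|w|^-1 *: w).
  move=> w0; rewrite /S /= normrZ gtr0_norm ?invr_gt0 ?normr_gt0//.
  by rewrite mulVf// normr_eq0.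
have bform0 : bform A 0 0 = 0 by rewrite /bform !mul0mx mxE.
have [S0|S0] := pselect (S !=set0); last first.
  exists 1 => // w; have [->|/scale Sw] := eqVneq w 0.
    by rewrite bform0 normr0 expr0n mulr0.
  by exfalso; apply: S0; exists (`|w|^-1 *: w).
have Scompact : compact S.
  apply: bounded_closed_compact.
    by exists 1; split => [|M M1 w /= ->]; [exact: num_real | exact: ltW].
  have -> : S = (fun w : 'rV[R]_n => `|w|) @^-1` [set 1] by [].
  by apply: preimage_closed; [by move=> w _; exact: norm_continuous | exact: closed_eq].
have [c + cmin] := EVT_min_rV S0 Scompact
  (continuous_subspaceT (@continuous_bformd A)).
rewrite inE => Sc; exists (bform A c c).
  by apply: Apos; apply: contraPneq Sc => -> /eqP; rewrite normr0 eq_sym oner_eq0.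
move=> w; have [->|w0] := eqVneq w 0; first by rewrite bform0 normr0 expr0n mulr0.
have := cmin _ (mem_set (scale _ w0)); rewrite bformZ exprVn mulrC.
by rewrite ler_pdivlMr// exprn_gt0// normr_gt0.
Qed.

Lemma ereal_sup_bform_attained (A B : 'M[R]_n) (v : 'rV[R]_n)
    (S := [set w : 'rV[R]_n | bform A w w = 1 /\ bform 1%:M w v = 0]) :
  posdef_mx A -> S !=set0 ->
  exists2 w, S w & ereal_sup [set (bform B w w)%:E | w in S] = (bform B w w)%:E.
Proof.
move=> /posdef_coercive[m m0 Am] S0.
have Scompact : compact S.
  apply: bounded_closed_compact.
    exists (1 + m^-1); split => [|M M1 w /= [w1 _]]; first exact: num_real.
    apply: le_trans (ltW M1); have := Am w; rewrite w1 mulrC -ler_pdivlMr// => wm.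
    have [w1'|/ltW w1'] := leP `|w| 1.
      by rewrite (le_trans w1')// lerDl invr_ge0 ltW.
    rewrite div1r in wm; rewrite (le_trans _ (le_trans wm _)) ?lerDr//.
    by rewrite expr2 ler_peMr.
  have -> : S = (fun w => bform A w w) @^-1` [set 1] `&`
                (fun w => bform 1%:M w v) @^-1` [set 0] by [].
  apply: closedI; apply: preimage_closed; try exact: closed_eq.
    by move=> w _; exact: continuous_bformd.
  by move=> w _; exact: continuous_bforml.
have [c + cmax] := EVT_max_rV S0 Scompact
  (continuous_subspaceT (@continuous_bformd B)).
rewrite inE => Sc; exists c => //; apply/eqP; rewrite eq_le; apply/andP; split.
  by apply: ge_ereal_sup => _ [w Sw <-]; rewrite lee_fin cmax// inE.
by apply: ereal_sup_ubound; exists c.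
Qed.

Lemma lambda_attained U f G x : riemannian_metric U G -> U x ->
  let S := [set w : 'rV[R]_n | bform (G x) w w = 1 /\ bform (G x) w (f x) = 0] in
  S !=set0 -> exists2 w, S w & lambda f G x =
    (bform (G x *m Jmx f x + 2^-1 *: orbital_derivative f G x) w w)%:E.
Proof.
move=> [_ Gpos] /Gpos[_ Gx] S.
have -> : S = [set w | bform (G x) w w = 1 /\
                       bform 1%:M w (f x *m (G x)^T) = 0].
  by apply/seteqP; split => w /=; rewrite /S/= /bform mulmx1 trmx_mul trmxK mulmxA.
move=> S0; have [w Sw wE] := ereal_sup_bform_attained
  (G x *m Jmx f x + 2^-1 *: orbital_derivative f G x) Gx S0.
exists w => //; rewrite -wE /lambda; congr (ereal_sup (_ @` _)).
by apply/seteqP; split => z /=; rewrite /bform mulmx1 trmx_mul trmxK mulmxA.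
Qed.

Lemma lambda'_attained f G x :
  let S := [set w : 'rV[R]_n | (w *m w^T) 0 0 = 1 /\ (w *m (f x)^T) 0 0 = 0] in
  S !=set0 -> exists2 w, S w & lambda' f G x =
    (bform (Jmx f x *m G x - 2^-1 *: orbital_derivative f G x) w w)%:E.
Proof.
move=> S.
have SE : S = [set w | bform 1%:M w w = 1 /\ bform 1%:M w (f x) = 0].
  by apply/seteqP; split => w /=; rewrite /S/= /bform !mulmx1.
rewrite SE => S0; have [w Sw wE] := ereal_sup_bform_attained
  (Jmx f x *m G x - 2^-1 *: orbital_derivative f G x) posdef_mx1 S0.
by exists w => //; rewrite -wE /lambda' -/S SE.
Qed.

End RiemannianMetric.

(* Main.v *)
Require Import Defs.
From HB Require Import structures.
From mathcomp Require Import all_boot all_order all_algebra.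
From mathcomp Require Import all_classical all_reals all_analysis.
From mathcomp Require Import ring lra.
From mathcomp Require mpoly.
Import Order.TTheory GRing.Theory Num.Theory.
Import numFieldNormedType.Exports.
Local Open Scope classical_set_scope.
Local Open Scope ring_scope.

(** The theorem has an algebraic half and an analytic half.

    Passing from a metric [G] to the pointwise inverse [H] exchanges [lambda]
    and [lambda']. Differentiating [G H = 1] gives [H' = - H G' H] for the
    orbital derivatives, so the quadratic form of [lambda'] for [H] at [v] is
    the form of [lambda] for [G] at [w = v H] ([dual_form]), and orthogonality
    of [w] to [f] for [G] is Euclidean orthogonality of [v] to [f]. Only the
    normalisations differ: [w] has [G]-length [1] while [v] has Euclidean
    length [1]. Both bounds are homogeneous of degree two
    ([sup_le_homogeneous]), and on the compact set [K] the two lengths are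
    comparable ([metric_ge], [metric_le]), so that the change of normalisation
    only changes the constant [c].

    The form of [lambda'] is affine in [G] and its first derivatives, and [f]
    and its Jacobian matrix are bounded on [K]. Hence a strict bound for [G]
    survives any perturbation of [G] that is small on [K] together with its
    first derivatives, and it is enough to find a polynomial metric that is
    close to [G] in this sense ([polynomial_metric_approx]). The difficulty is
    that it must be positive definite on all of [U], not only near [K].

    - A cutoff [chi] turns [G] into the metric [chi (G - 1) + 1] of class C1
      on the whole space, with the same value and first derivatives as [G] on
      [K] ([metric_extension]).
    - The entries of this extension are approximated by polynomials on a large
      cube, with their first derivatives ([C1_weierstrass]). Bernstein
      averaging is applied to one coordinate after the other; it commutes with
      the derivatives along the other coordinates, and its derivative along
      the averaged coordinate is the Bernstein average of difference
      quotients. The matrices so obtained are positive definite on the cube,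
      by compactness.
    - Outside the cube the polynomial entries grow at most like a power of the
      distance to the origin. Adding [sum_i (x_i / s) ^ 2N] times the identity
      restores positivity there when [N] is large, and it perturbs the metric
      and its first derivatives as little as desired on [K], where
      [|x_i / s| <= 1/2]. *)

Set Implicit Arguments.
Unset Strict Implicit.
Unset Printing Implicit Defensive.

(** * Functions of class C1 *)

Section C1_functions.
Context {R : realType} {n : nat}.
Local Notation E := 'rV[R]_n.
Local Notation C1 := (@C1_on R n R^o).
Implicit Types (U : set E) (g h : E -> R) (x v : E).

Lemma near_continuous (T S : topologicalType) (f g : T -> S) (x : T) :
  (\near x, f x = g x) -> {for x, continuous f} -> {for x, continuous g}.
Proof.
move=> fg fc; rewrite /prop_for /continuous_at -(nbhs_singleton fg).
apply: cvg_trans fc; apply: near_eq_cvg.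
by apply: filterS fg => y ->.
Qed.

(** Differentiability is a local notion; this is the special case from which
    [C1_on_near] follows by subtraction. *)
Lemma near0_differentiable (V W : normedModType R) (k : V -> W) (x : V) :
  (\near x, k x = 0) -> differentiable k x.
Proof.
move=> k0; pose z : {linear V -> W} := \0.
have kl : k \o shift x = cst (k x) + z +o_ 0 id.
  apply/eqaddoP => e e0; rewrite (nbhs_singleton k0).
  have : \forall y \near (0 : V), k (shift x y) = 0.
    by move: k0; rewrite [X in X -> _](near_shift 0 x) subr0.
  apply: filterS => y; rewrite !fctE /= => ->.
  by rewrite !addr0 subrr normr0 mulr_ge0// ltW.
have c0 : continuous z by move=> y; exact: cst_continuous.
by apply/diff_locallyP; rewrite (diff_unique c0 kl).
Qed.

(** On an open set, a pointwise formula for the directional derivatives is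
    enough: it holds in a neighborhood, which is what continuity requires. *)
Lemma C1_onI U g (dg : E -> E -> R) : open U ->
  (forall x, U x -> differentiable (g : E -> R^o) x) ->
  (forall x v, U x -> 'D_v (g : E -> R^o) x = dg v x) ->
  (forall x v, U x -> {for x, continuous (dg v)}) -> C1 U g.
Proof.
move=> Uo gd gE dgc x Ux; split=> [|v]; first exact: gd.
apply: (@near_continuous _ _ (dg v)); last exact: dgc.
have : \near x, U x by apply: open_nbhs_nbhs.
by apply: filterS => y /gE ->.
Qed.

Lemma C1_on_near U g h : (forall x, U x -> \near x, g x = h x) ->
  C1 U g -> C1 U h.
Proof.
move=> gh gC x Ux; have [gd gc] := gC _ Ux; split=> [|v].
  have -> : (h : E -> R^o) = g + (h - g :> (E -> R^o)).
    by apply/funext => y; rewrite !fctE addrC subrK.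
  apply: differentiableD => //; apply: near0_differentiable.
  by apply: filterS (gh _ Ux) => y; rewrite !fctE => ->; rewrite subrr.
apply: near_continuous (gc v).
have := near_join (gh _ Ux); apply: filterS => y; exact: near_eq_derive.
Qed.

Lemma C1_on_derivable U g x v : C1 U g -> U x -> derivable (g : E -> R^o) x v.
Proof. by move=> gC /gC[gd _]; exact: diff_derivable. Qed.

Lemma C1_on_continuous U g x : C1 U g -> U x -> {for x, continuous g}.
Proof. by move=> gC /gC[gd _]; exact: (differentiable_continuous gd). Qed.

Lemma C1_onS U U' g : U `<=` U' -> C1 U' g -> C1 U g.
Proof. by move=> sub gC x /sub; exact: gC. Qed.

Lemma C1_on_cst U (a : R) : C1 U (fun=> a).
Proof.
move=> x _; split=> [|v]; first exact: differentiable_cst.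
suff -> : 'D_v (fun=> a : R^o) = ((fun=> 0) : E -> R^o) by exact: cst_continuous.
by apply/funext => y; exact: derive_cst.
Qed.

Lemma derive_on_add U g h x v : C1 U g -> C1 U h -> U x ->
  'D_v (fun y => g y + h y : R^o) x = 'D_v (g : E -> R^o) x + 'D_v (h : E -> R^o) x.
Proof.
move=> gC hC Ux.
exact: (deriveD (C1_on_derivable gC Ux) (C1_on_derivable hC Ux)).
Qed.

Lemma C1_on_add U g h : open U -> C1 U g -> C1 U h ->
  C1 U (fun x => g x + h x).
Proof.
move=> Uo gC hC; apply: (C1_onI (dg := fun v x =>
  'D_v (g : E -> R^o) x + 'D_v (h : E -> R^o) x)) => [//|x Ux|x v Ux|x v Ux].
- by apply: differentiableD; [case: (gC _ Ux)|case: (hC _ Ux)].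
- exact: (derive_on_add _ gC hC Ux).
- by apply: continuousD; [case: (gC _ Ux)|case: (hC _ Ux)].
Qed.

Lemma derive_on_mul U g h x v : C1 U g -> C1 U h -> U x ->
  'D_v (fun y => g y * h y : R^o) x =
    g x * 'D_v (h : E -> R^o) x + h x * 'D_v (g : E -> R^o) x.
Proof.
move=> gC hC Ux.
exact: (deriveM (C1_on_derivable gC Ux) (C1_on_derivable hC Ux)).
Qed.

Lemma C1_on_mul U g h : open U -> C1 U g -> C1 U h ->
  C1 U (fun x => g x * h x).
Proof.
move=> Uo gC hC; apply: (C1_onI (dg := fun v x =>
  g x * 'D_v (h : E -> R^o) x + h x * 'D_v (g : E -> R^o) x)) =>
  [//|x Ux|x v Ux|x v Ux].
- by apply: differentiableM; [case: (gC _ Ux)|case: (hC _ Ux)].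
- exact: (derive_on_mul _ gC hC Ux).
- have [_ /(_ v) gv] := gC _ Ux; have [_ /(_ v) hv] := hC _ Ux.
  have gc := C1_on_continuous gC Ux; have hc := C1_on_continuous hC Ux.
  exact: (continuousD (continuousM gc hv) (continuousM hc gv)).
Qed.

Lemma C1_on_sum U (I : Type) (r : seq I) (F : I -> E -> R) : open U ->
  (forall i, C1 U (F i)) -> C1 U (fun x => \sum_(i <- r) F i x).
Proof.
move=> Uo FC; elim: r => [|i r IH].
  by under eq_fun do rewrite big_nil; exact: C1_on_cst.
by under eq_fun do rewrite big_cons; exact: (C1_on_add Uo (FC i) IH).
Qed.

Lemma derive_on_sum U (I : Type) (r : seq I) (F : I -> E -> R) x v : open U ->
  (forall i, C1 U (F i)) -> U x ->
  'D_v (fun y => \sum_(i <- r) F i y : R^o) x =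
    \sum_(i <- r) 'D_v (F i : E -> R^o) x.
Proof.
move=> Uo FC Ux; elim: r => [|i r IH].
  by under eq_fun do rewrite big_nil; rewrite big_nil derive_cst.
under eq_fun do rewrite big_cons.
by rewrite (derive_on_add _ (FC i) (C1_on_sum r Uo FC) Ux) IH big_cons.
Qed.

Lemma C1_on_prod U (I : Type) (r : seq I) (F : I -> E -> R) : open U ->
  (forall i, C1 U (F i)) -> C1 U (fun x => \prod_(i <- r) F i x).
Proof.
move=> Uo FC; elim: r => [|i r IH].
  by under eq_fun do rewrite big_nil; exact: C1_on_cst.
by under eq_fun do rewrite big_cons; exact: (C1_on_mul Uo (FC i) IH).
Qed.

Lemma derive_coord (i : 'I_n) x v : 'D_v (fun y : E => y 0 i : R^o) x = v 0 i.
Proof.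
rewrite deriveE; last exact: differentiable_coord.
have @f : {linear E -> R^o}.
  by exists (fun N : E => N 0 i); do 2![eexists]; do ?[constructor];
     rewrite ?mxE// => ? *; rewrite ?mxE//; move=> ?; rewrite !mxE.
rewrite (_ : (fun _ => _) = f)// diff_lin//; exact: coord_continuous.
Qed.

Lemma C1_on_coord U (i : 'I_n) : open U -> C1 U (fun x => x 0 i).
Proof.
move=> Uo; apply: (C1_onI (dg := fun v _ => v 0 i)) => // [x _|x v _|x v _].
- exact: differentiable_coord.
- exact: derive_coord.
- exact: cst_continuous.
Qed.

Lemma derive_on_comp U g (phi : R -> R) (d : R) x v : C1 U g -> U x ->
  is_derive (g x) 1 (phi : R -> R^o) d ->
  differentiable (fun y => phi (g y) : R^o) x /\
  'D_v (fun y => phi (g y) : R^o) x = d * 'D_v (g : E -> R^o) x.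
Proof.
move=> gC Ux [pd pE]; have [gd _] := gC _ Ux.
have {}pd : differentiable (phi : R -> R^o) (g x : R^o).
  by apply/derivable1_diffP.
split; first exact: differentiable_comp.
rewrite deriveE; last exact: differentiable_comp.
rewrite -[X in 'd X _]/((phi : R^o -> R^o) \o (g : E -> R^o)) diff_comp//=.
rewrite -pE (deriveE _ pd) (deriveE _ gd).
by rewrite -[X in 'd phi _ X]mulr1 [LHS]linearZ mulrC.
Qed.

Lemma C1_on_comp U g (phi dphi : R -> R) : open U -> C1 U g ->
  (forall x, U x -> is_derive (g x) 1 (phi : R -> R^o) (dphi (g x))) ->
  (forall x, U x -> {for g x, continuous dphi}) ->
  C1 U (fun x => phi (g x)).
Proof.
move=> Uo gC pd dpc.
apply: (C1_onI (dg := fun v x => dphi (g x) * 'D_v (g : E -> R^o) x)) => //.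
- by move=> x Ux; have [] := derive_on_comp 0 gC Ux (pd _ Ux).
- by move=> x v Ux; have [] := derive_on_comp v gC Ux (pd _ Ux).
- move=> x v Ux; have [_ /(_ v) gv] := gC _ Ux; apply: continuousM => //.
  by apply: continuous_comp; [exact: C1_on_continuous Ux|exact: dpc].
Qed.

Lemma C1_on_inv U g : open U -> C1 U g -> (forall x, U x -> g x != 0) ->
  C1 U (fun x => (g x)^-1).
Proof.
move=> Uo gC g0; apply: (C1_on_comp (dphi := fun t => - t ^- 2)) => //.
  move=> x Ux; have := is_deriveV (f := id) (g0 _ Ux) (is_derive_id (g x : R^o) 1).
  by rewrite /GRing.scale/= mulr1; exact.
move=> x Ux; apply: continuousN; apply: continuousV; first by rewrite expf_neq0// g0.
exact: exprn_continuous.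
Qed.

Lemma C1_on_mxP m p U (G : E -> 'M[R]_(m, p)) : open U ->
  C1_on U G <-> forall i j, C1 U (fun x => G x i j).
Proof.
move=> Uo; split=> [GC i j|GC].
  apply: (@C1_onI U (fun x => G x i j) (fun v x => ('D_v G x) i j)) => // x.
  - move=> Ux; have [Gd _] := GC _ Ux.
    apply: (differentiable_comp (g := fun N : 'M[R]_(m, p) => N i j : R^o)) => //.
    exact: differentiable_coord.
  - move=> v Ux; have [Gd _] := GC _ Ux.
    by rewrite derive_mx ?mxE//; exact: diff_derivable.
  - move=> v Ux; have [_ /(_ v) Gc] := GC _ Ux.
    exact: (continuous_comp Gc (@coord_continuous _ _ _ i j _)).
have GE : G = \sum_i \sum_j (fun x => G x i j *: delta_mx i j).
  apply/funext => x; rewrite [LHS]matrix_sum_delta fct_sumE.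
  by apply: eq_bigr => i _; rewrite fct_sumE.
move=> x Ux; have Gd : forall y, U y -> differentiable G y.
  move=> y Uy; rewrite GE; apply: differentiable_sum => i.
  apply: differentiable_sum => j; apply: differentiableZl.
  by have [] := GC i j _ Uy.
split=> [|v]; first exact: Gd.
pose H y := \sum_i \sum_j
  ('D_v (fun z => G z i j : R^o) y *: delta_mx i j : 'M[R]_(m, p)).
refine (near_continuous (f := H) _ _).
  have : \near x, U x by apply: open_nbhs_nbhs.
  apply: filterS => y Uy; rewrite derive_mx; last exact/diff_derivable/Gd.
  rewrite [RHS]matrix_sum_delta.
  by apply: eq_bigr => i _; apply: eq_bigr => j _; rewrite mxE.
rewrite /prop_for /continuous_at /H.
have addc : continuous (fun z : 'M[R]_(m, p) * 'M[R]_(m, p) => z.1 + z.2).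
  by move=> z; apply: cvgD; [exact: cvg_fst | exact: cvg_snd].
apply: (cvg_big addc (F := nbhs x)) => i _.
apply: (cvg_big addc (F := nbhs x)) => j _.
by apply: cvgZr_tmp; have [_] := GC i j _ Ux; apply.
Qed.

End C1_functions.

(** * Bernstein averages *)

Section bernstein_mean.
Context {R : realType}.
Implicit Types (phi psi : nat -> R) (s a : R).

(** [bern m phi s] is the mean of [phi] under the binomial law with parameters
    [m] and [s], that is, the Bernstein polynomial of degree [m] of the values
    [phi 0, ..., phi m]. The recursion conditions on the first trial, and makes
    each property below a direct induction. *)
Fixpoint bern (m : nat) phi s : R :=
  if m is m'.+1 then
    (1 - s) * bern m' phi s + s * bern m' (fun k => phi k.+1) s
  else phi 0%N.

Lemma bern_cst m a s : bern m (fun=> a) s = a.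
Proof. by elim: m => //= m ->; ring. Qed.

Lemma bernB m phi psi s :
  bern m (fun k => phi k - psi k) s = bern m phi s - bern m psi s.
Proof. by elim: m phi psi => //= m IH phi psi; rewrite !IH; ring. Qed.

Lemma bernD m phi psi s :
  bern m (fun k => phi k + psi k) s = bern m phi s + bern m psi s.
Proof. by elim: m phi psi => //= m IH phi psi; rewrite !IH; ring. Qed.

Lemma bernZ m phi a s : bern m (fun k => a * phi k) s = a * bern m phi s.
Proof. by elim: m phi => //= m IH phi; rewrite !IH; ring. Qed.

Lemma bern_le m phi psi s : 0 <= s <= 1 ->
  (forall k, (k <= m)%N -> phi k <= psi k) -> bern m phi s <= bern m psi s.
Proof.
move=> /andP[s0 s1]; elim: m phi psi => [|m IH] phi psi le /=; first exact: le.
apply: lerD; apply: ler_wpM2l; rewrite ?subr_ge0//; apply: IH => k km.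
  by apply: le; rewrite ltnW.
exact: le.
Qed.

Lemma ler_norm_bern m phi s : 0 <= s <= 1 ->
  `|bern m phi s| <= bern m (fun k => `|phi k|) s.
Proof.
move=> s01; rewrite ler_norml -[- _]mulN1r -bernZ.
apply/andP; split; apply: bern_le => // k _; last exact: ler_norm.
by rewrite mulN1r lerNl -normrN ler_norm.
Qed.

(** The second moment about an arbitrary point [a] is what the induction needs,
    since conditioning on the first trial shifts [a]; it gives the variance
    [m s (1 - s)] of the binomial law at [a = m s]. *)
Lemma bern_variance m a s :
  bern m (fun k => (k%:R - a) ^+ 2) s = (m%:R * s - a) ^+ 2 + m%:R * s * (1 - s).
Proof.
elim: m a => [|m IH] a /=; first by ring.
have -> : bern m (fun k => (k.+1%:R - a) ^+ 2) s =
    bern m (fun k => (k%:R - (a - 1)) ^+ 2) s.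
  by congr bern; apply/funext => k; rewrite -natr1; ring.
by rewrite !IH -natr1; ring.
Qed.

End bernstein_mean.

Section bernstein_approximation.
Context {R : realType} {n : nat}.
Local Notation E := 'rV[R]_n.
Local Notation C1 := (@C1_on R n R^o setT).
Implicit Types (g h : E -> R) (x v : E) (i j : 'I_n) (d m k : nat).

Lemma coord_le_norm x i : `|x 0 i| <= `|x|.
Proof.
rewrite [leRHS]/Num.norm/= mx_normrE.
exact: (le_bigmax _ (fun ij : 'I_1 * 'I_n => `|x ij.1 ij.2|) (0, i)).
Qed.

Lemma norm_le_coord x (a : R) : 0 <= a -> (forall i, `|x 0 i| <= a) -> `|x| <= a.
Proof.
move=> a0 xa; rewrite [leLHS]/Num.norm/= mx_normrE; apply: bigmax_le => // -[k i] _ /=.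
by rewrite (ord1 k).
Qed.

Lemma bern_C1 m (h : nat -> E -> R) (sg : E -> R) :
  (forall k, C1 (h k)) -> C1 sg -> C1 (fun x => bern m (h^~ x) (sg x)).
Proof.
move=> + sgC; elim: m h => [|m IH] h hC /=; first exact: hC.
apply: C1_on_add; first exact: openT.
  apply: C1_on_mul; [exact: openT| |exact: IH].
  have -> : (fun x => 1 - sg x) = (fun x => 1 + (-1) * sg x).
    by apply/funext => x; ring.
  apply: C1_on_add; [exact: openT|exact: C1_on_cst|].
  by apply: C1_on_mul; [exact: openT|exact: C1_on_cst|].
apply: C1_on_mul; [exact: openT|exact: sgC|].
exact: (IH (fun k => h k.+1) (fun k => hC k.+1)).
Qed.

(** The last summand comes from the variable [sg x] of the Bernstein
    polynomial: differentiating in it gives [m] times the average, of degree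
    one less, of the forward differences of the values. *)
Lemma derive_bern m (h : nat -> E -> R) (sg : E -> R) x v :
  (forall k, C1 (h k)) -> C1 sg ->
  'D_v (fun x => bern m (h^~ x) (sg x) : R^o) x =
    bern m (fun k => 'D_v (h k : E -> R^o) x) (sg x) +
    m%:R * 'D_v (sg : E -> R^o) x *
      bern m.-1 (fun k => h k.+1 x - h k x) (sg x).
Proof.
move=> + sgC; elim: m h => [|m IH] h hC /=; first by rewrite !mul0r addr0.
have C1N : C1 (fun x => 1 + (-1) * sg x).
  apply: C1_on_add; [exact: openT|exact: C1_on_cst|].
  by apply: C1_on_mul; [exact: openT|exact: C1_on_cst|].
under eq_fun do rewrite -[- sg _]mulN1r.
have hC' k : C1 (h k.+1) := hC k.+1.
have bC := bern_C1 m hC sgC; have bC' := bern_C1 m hC' sgC.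
rewrite (derive_on_add v (C1_on_mul openT C1N bC) (C1_on_mul openT sgC bC'))//.
rewrite (derive_on_mul v C1N bC)// (derive_on_mul v sgC bC')//.
rewrite IH// (IH (fun k => h k.+1))//.
rewrite (derive_on_add v (C1_on_cst 1) (C1_on_mul openT (C1_on_cst (-1)) sgC))//.
rewrite (derive_on_mul v (C1_on_cst (-1)) sgC)// !derive_cst !bernB.
case: m {IH bC bC'} => [|m] /=; first by ring.
by rewrite -!natr1; ring.
Qed.

(** The point [x] with its [i]-th coordinate replaced by [c]. As an affine
    expression it is visibly differentiable in [x] and in [c]. *)
Definition setc i (c : R) x : E := x + (c - x 0 i) *: delta_mx 0 i.

Lemma setcE i c x j : setc i c x 0 j = if j == i then c else x 0 j.
Proof.
rewrite !mxE eqxx/=; case: eqVneq => [->|_]; first by rewrite mulr1 addrC subrK.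
by rewrite mulr0 addr0.
Qed.

Lemma setc_in_box i c x (L : R) : `|x| <= L -> `|c| <= L -> `|setc i c x| <= L.
Proof.
move=> xL cL; apply: norm_le_coord => [|j]; first exact: le_trans xL.
by rewrite setcE; case: eqP => // _; exact: le_trans (coord_le_norm _ _) xL.
Qed.

Lemma setc_sub i c x : `|setc i c x - x| <= `|c - x 0 i|.
Proof.
apply: norm_le_coord => // j.
rewrite !mxE eqxx/= [x 0 j + _]addrC addrK; case: eqP => _.
  by rewrite mulr1.
by rewrite mulr0 normr0.
Qed.

Lemma derive_setc i c g x v : C1 g -> C1 (g \o setc i c) /\
  'D_v (g \o setc i c : E -> R^o) x = 'D_(setc i 0 v) (g : E -> R^o) (setc i c x).
Proof.
have setcL (t : R) (w y : E) : setc i c (t *: w + y) = t *: setc i 0 w + setc i c y.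
  apply/rowP => j; rewrite setcE [RHS]mxE [X in _ = X + _]mxE !setcE !mxE.
  by case: eqP => _; ring.
have DE w y : 'D_w (g \o setc i c : E -> R^o) y =
    'D_(setc i 0 w) (g : E -> R^o) (setc i c y).
  rewrite /derive; set a := (X in lim (X @ _)); set b := (X in _ = lim (X @ _)).
  by have -> : a = b by apply/funext => t; rewrite /a /b /= setcL.
have setcd y : differentiable (setc i c) y.
  apply: (@differentiableD _ _ _ id); first exact: (ex_diff (f := id)).
  apply: (@differentiableZl _ _ _ (fun y : E => c - y 0 i)).
  apply: (@differentiableB _ _ _ (cst c)); first exact: differentiable_cst.
  exact: differentiable_coord.
move=> gC; split; last exact: DE.
move=> y _; have [gd gc] := gC (setc i c y) I; split=> [|w].
  exact: (differentiable_comp (setcd _) gd).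
have -> : 'D_w (g \o setc i c : E -> R^o) =
    'D_(setc i 0 w) (g : E -> R^o) \o setc i c by apply/funext => z; rewrite DE.
exact: (continuous_comp (differentiable_continuous (setcd y)) (gc _)).
Qed.

Lemma is_derive_setc i g x (t : R) : C1 g ->
  is_derive t 1 ((fun c => g (setc i c x)) : R -> R^o)
    ('D_(delta_mx 0 i) (g : E -> R^o) (setc i t x)).
Proof.
move=> gC.
have F : (fun h : R => h^-1 *:
      ((((fun c => g (setc i c x)) : R -> R^o) \o shift t) (h *: 1)
       - g (setc i t x) : R^o)) =
    (fun h : R => h^-1 *:
      (((g : E -> R^o) \o shift (setc i t x)) (h *: delta_mx 0 i)
       - g (setc i t x) : R^o)).
  apply/funext => h /=; congr (_ *: (g _ - _)).
  by apply/rowP => j; rewrite !mxE eqxx/= /GRing.scale/=; case: eqP => _ /=; ring.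
have gd : derivable (g : E -> R^o) (setc i t x) (delta_mx 0 i).
  exact: C1_on_derivable gC I.
by split; rewrite ?/derivable ?/derive F.
Qed.

End bernstein_approximation.

Section uniform_bernstein.
Context {R : realType} {n : nat}.
Local Notation E := 'rV[R]_n.
Local Notation C1 := (@C1_on R n R^o setT).
Implicit Types (g h : E -> R) (x y v : E) (i j : 'I_n) (d m k : nat) (L e : R).

Lemma compact_box L : compact [set x : E | `|x| <= L].
Proof.
apply: bounded_closed_compact.
  by exists L; split => [|M LM x /= xL]; [exact: num_real|exact: le_trans (ltW LM)].
have -> : [set x : E | `|x| <= L] = (fun x : E => `|x|) @^-1` [set t | t <= L] by [].
by apply: preimage_closed; [move=> w _; exact: norm_continuous | exact: closed_le].
Qed.

Lemma compact_norm_bounded (T : topologicalType) (K : set T) (h : T -> R) :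
  compact K -> (forall t, K t -> {for t, continuous h}) ->
  exists2 M, 0 < M & forall t, K t -> `|h t| <= M.
Proof.
move=> cK hc; have [K0|K0] := pselect (K !=set0); last first.
  by exists 1 => // t Kt; case: K0; exists t.
have hw : {within K, continuous (fun t => `|h t|)}.
  apply: continuous_in_subspaceT => t; rewrite inE => Kt.
  exact: (continuous_comp (hc _ Kt) (@norm_continuous _ _ _)).
have [c _ cM] := compact_EVT_max K0 cK hw.
exists (1 + `|h c|); first by rewrite ltr_wpDr.
by move=> t Kt; rewrite (le_trans (cM t (mem_set Kt)))// lerDr.
Qed.

Lemma box_uniform_continuity h L e : continuous h -> 0 < e ->
  exists2 r, 0 < r &
    forall x y, `|x| <= L -> `|y| <= L -> `|x - y| < r -> `|h y - h x| <= e.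
Proof.
move=> hc e0; have := @compact_box L; rewrite compact_near_coveringP.
pose P r x := forall y, `|x - y| < r -> `|h y - h x| <= e.
move=> /(_ _ (nbhs (0 : R)) P _)[].
  move=> x _; have /cvgrPdist_lt/(_ (e / 2)) := hc x.
  rewrite divr_gt0// => /(_ isT) /nbhs_ballP[r /= r0 xr].
  exists (ball x (r / 2), ball (0 : R) (r / 2)) => /=.
    by split; apply: nbhsx_ballx; rewrite divr_gt0.
  move=> [z s] /= []; rewrite -!ball_normE /= sub0r normrN => xz sr y zy.
  rewrite (splitr e) -[h y](subrK (h x)) -addrA (le_trans (ler_normD _ _))// lerD//.
    rewrite distrC ltW//; apply: xr; rewrite -ball_normE /=.
    rewrite (splitr r) -[x](subrK z) -addrA (le_lt_trans (ler_normD _ _))// ltrD//.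
    by rewrite (lt_trans zy)// (le_lt_trans _ sr)// ler_norm.
  apply/ltW/xr; rewrite -ball_normE /= (lt_trans xz)//.
  by rewrite ltr_pdivrMr// ltr_pMr// ltr1n.
move=> r /= r0 H; exists (r / 2); first by rewrite divr_gt0.
move=> x y xL _; apply: (H (r / 2)) => //=.
by rewrite sub0r normrN gtr0_norm ?divr_gt0// ltr_pdivrMr// ltr_pMr// ltr1n.
Qed.

(** Uniform continuity and boundedness in a form that averages well: the error
    is a constant plus a multiple of a squared distance, whose Bernstein mean
    is controlled by [bern_variance]. *)
Lemma box_quadratic_modulus h L e : continuous h -> 0 < e ->
  exists2 C, 0 < C & forall x y, `|x| <= L -> `|y| <= L ->
    `|h y - h x| <= e + C * `|x - y| ^+ 2.
Proof.
move=> hc e0; have [r r0 hr] := box_uniform_continuity L hc e0.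
have [M M0 hM] : exists2 M, 0 < M & forall x, `|x| <= L -> `|h x| <= M.
  by apply: compact_norm_bounded; [exact: compact_box|move=> x _; exact: hc].
exists (2 * M / r ^+ 2); first by rewrite divr_gt0 ?mulr_gt0 ?exprn_gt0.
move=> x y xL yL; have [xy|xy] := ltP `|x - y| r.
  rewrite (le_trans (hr _ _ xL yL xy))// lerDl mulr_ge0 ?sqr_ge0//.
  by rewrite divr_ge0 ?mulr_ge0 ?sqr_ge0// ltW.
apply: (@le_trans _ _ (2 * M)).
  by rewrite (le_trans (ler_normB _ _))// mulr_natl mulr2n lerD ?hM.
apply: (@le_trans _ _ (2 * M / r ^+ 2 * `|x - y| ^+ 2)).
  rewrite mulrAC ler_pdivlMr ?exprn_gt0// ler_wpM2l ?mulr_ge0 ?(ltW M0)//.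
  by rewrite lerXn2r ?nnegrE// ltW.
by rewrite lerDr ltW.
Qed.

(** [chart L] maps [[-L, L]] affinely onto [[0, 1]], and [node L m k] is the
    point that it sends to [k / m]. *)
Definition chart L (t : R) : R := 2^-1 + t / (2 * L).
Definition node L m k : R := L * (2 * k%:R / m%:R - 1).

Lemma chart01 L t : 0 < L -> `|t| <= L -> 0 <= chart L t <= 1.
Proof.
move=> L0; rewrite ler_norml => /andP[t1 t2]; rewrite /chart.
have -> : 2^-1 + t / (2 * L) = (L + t) / (2 * L) :> R by field; lra.
by rewrite divr_ge0 ?ler_pdivrMr; lra.
Qed.

(** The sample points [xi k] need not be the nodes themselves. This freedom is
    used for the derivative of an average, which samples the derivative at the
    intermediate points provided by the mean value theorem. *)
Lemma bern_approx h L e i : continuous h -> 0 < L -> 0 < e ->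
  exists m0, forall m, (m0 < m)%N -> forall x, `|x| <= L ->
    forall xi : nat -> R,
    (forall k, (k <= m)%N -> `|xi k| <= L /\ `|xi k - node L m k| <= 2 * L / m%:R) ->
    `|bern m (fun k => h (setc i (xi k) x)) (chart L (x 0 i)) - h x| <= e.
Proof.
move=> hc L0 e0; have e20 : 0 < e / 2 by rewrite divr_gt0.
have [C C0 hC] := box_quadratic_modulus L hc e20.
exists (Num.bound (C * (20 * L ^+ 2) / e)) => m mm x xL xi xiP.
have m0 : 0 < m%:R :> R by rewrite ltr0n (leq_trans _ mm).
have m1 : 1 <= m%:R :> R by rewrite ler1n (leq_trans _ mm).
have xiL : `|x 0 i| <= L := le_trans (coord_le_norm _ _) xL.
have s01 := chart01 L0 xiL; set s := chart L _ in s01 *.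
rewrite -(bern_cst m (h x) s) -bernB.
rewrite (le_trans (ler_norm_bern _ _ s01))//.
(* by the inequality [(a + b)^2 <= 2 a^2 + 2 b^2], [D] bounds the part of the
   squared distance due to [xi k], and the rest is a variance *)
pose D := 8 * L ^+ 2 / m%:R ^+ 2.
apply: (@le_trans _ _ (bern m (fun k => (e / 2 + C * D) +
    C * (8 * L ^+ 2 / m%:R ^+ 2) * (k%:R - m%:R * s) ^+ 2) s)).
  apply: bern_le => // k km; have [xikL xikn] := xiP k km.
  rewrite (le_trans (hC x _ xL _))//; first exact: setc_in_box.
  rewrite -addrA lerD2l -mulrA -mulrDr ler_wpM2l ?(ltW C0)//.
  have -> : D + 8 * L ^+ 2 / m%:R ^+ 2 * (k%:R - m%:R * s) ^+ 2 =
      2 * (2 * L / m%:R) ^+ 2 + 2 * (node L m k - x 0 i) ^+ 2.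
    by rewrite /D /node /s /chart; field; rewrite !gt_eqF.
  apply: (@le_trans _ _ (`|xi k - x 0 i| ^+ 2)).
    by rewrite lerXn2r ?nnegrE// distrC setc_sub.
  move: xikn; rewrite real_normK ?num_real// ler_norml.
  move: (2 * L / _) (node _ _ _) (xi k) => a b c /andP[ca cb].
  have : (c - b) ^+ 2 <= a ^+ 2 by nra.
  by have := sqr_ge0 (c - 2 * b + x 0 i); nra.
rewrite bernD bern_cst bernZ bern_variance subrr expr0n/= add0r.
have -> : C * (8 * L ^+ 2 / m%:R ^+ 2) * (m%:R * s * (1 - s)) =
    C * (8 * L ^+ 2) / m%:R * (s * (1 - s)) by field; rewrite gt_eqF.
have ss : s * (1 - s) <= 4^-1 by have := sqr_ge0 (s - 2^-1); nra.
have DD : C * D <= C * (8 * L ^+ 2) / m%:R.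
  have -> : C * D = C * (8 * L ^+ 2) / m%:R * m%:R^-1.
    by rewrite /D; field; rewrite gt_eqF.
  by rewrite ler_piMr ?invf_le1// divr_ge0 ?mulr_ge0 ?sqr_ge0// ltW.
have CL : C * (8 * L ^+ 2) / m%:R * (s * (1 - s)) <= C * (8 * L ^+ 2) / m%:R * 4^-1.
  by rewrite ler_wpM2l// divr_ge0 ?mulr_ge0 ?sqr_ge0// ltW.
have : C * (20 * L ^+ 2) / e < m%:R.
  apply: lt_trans (archi_boundP _) _; last by rewrite ltr_nat.
  by rewrite divr_ge0 ?mulr_ge0 ?sqr_ge0// ltW.
rewrite ltr_pdivrMr// => me.
have : C * (8 * L ^+ 2) / m%:R <= e * 2 / 5.
  by rewrite ler_pdivrMr//; nra.
by lra.
Qed.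

End uniform_bernstein.

(** * Polynomial approximation of class C1 *)

Section C1_weierstrass.
Context {R : realType} {n : nat}.
Local Notation E := 'rV[R]_n.
Local Notation C1 := (@C1_on R n R^o setT).
Implicit Types (g h : E -> R) (x y v : E) (i j : 'I_n) (d m k : nat) (L e : R).

(** Functions that are polynomial in the coordinates of index less than [d],
    with arbitrary functions of the remaining coordinates as coefficients. For
    [d = 0] these are all functions, and for [d = n] the polynomials, so that
    [d] counts the coordinates already averaged. *)
Inductive poly_below d : (E -> R) -> Prop :=
| poly_below_coord j : (j < d)%N -> poly_below d (fun x => x 0 j)
| poly_below_free h :
    (forall x y, (forall j, (d <= j)%N -> x 0 j = y 0 j) -> h x = h y) ->
    poly_below d h
| poly_below_add g h :
    poly_below d g -> poly_below d h -> poly_below d (fun x => g x + h x)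
| poly_below_mul g h :
    poly_below d g -> poly_below d h -> poly_below d (fun x => g x * h x).

Lemma poly_below_cst d (a : R) : poly_below d (fun=> a).
Proof. exact: poly_below_free. Qed.

(** Fixing the coordinate [i] makes the coefficients independent of it. *)
Lemma poly_below_setc i c g : poly_below i g -> poly_below i.+1 (g \o setc i c).
Proof.
elim=> [j ji|h hfree|{}g h _ IHg _ IHh|{}g h _ IHg _ IHh].
- have -> : (fun x => x 0 j) \o setc i c = (fun x : E => x 0 j).
    apply/funext => x /=; rewrite setcE; case: eqP ji => // ->.
    by rewrite ltnn.
  exact/poly_below_coord/leqW.
- apply: poly_below_free => x y xy; apply: hfree => j ij; rewrite !setcE.
  by case: eqVneq => // ji; rewrite xy// ltn_neqAle ij andbT eq_sym.
- exact: poly_below_add.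
- exact: poly_below_mul.
Qed.

Lemma poly_below_bern d m (h : nat -> E -> R) (sg : E -> R) :
  (forall k, poly_below d (h k)) -> poly_below d sg ->
  poly_below d (fun x => bern m (h^~ x) (sg x)).
Proof.
move=> + sgP; elim: m h => [|m IH] h hP /=; first exact: hP.
apply: poly_below_add; apply: poly_below_mul => //; first last.
- exact: (IH (fun k => h k.+1)).
- exact: IH.
have -> : (fun x => 1 - sg x) = (fun x => 1 + (-1) * sg x).
  by apply/funext => x; ring.
apply: poly_below_add; first exact: poly_below_cst.
by apply: poly_below_mul; first exact: poly_below_cst.
Qed.

Lemma derive_along_continuous g v : C1 g -> continuous ('D_v (g : E -> R^o)).
Proof. by move=> gC x; have [_] := gC x I; apply. Qed.

Lemma C1_continuous g : C1 g -> continuous g.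
Proof. by move=> gC x; exact: C1_on_continuous gC I. Qed.

Lemma node_bound L m k : 0 < L -> (k <= m)%N -> (0 < m)%N -> `|node L m k| <= L.
Proof.
move=> L0 km m0; rewrite /node normrM gtr0_norm// ler_piMr ?(ltW L0)// ler_norml.
have M0 : 0 < m%:R :> R by rewrite ltr0n.
have : (2 * k%:R / m%:R : R) <= 2 by rewrite ler_pdivrMr// ler_pM2l// ler_nat.
have : 0 <= (2 * k%:R / m%:R : R) by rewrite divr_ge0// ?ltW// mulr_ge0.
by lra.
Qed.

Lemma node_step L m k : node L m.+1 k.+1 - node L m.+1 k = 2 * L / m.+1%:R.
Proof. by rewrite /node -(natr1 k); field; rewrite lt0r_neq0. Qed.

(** The node [k/m] lies between [k/(m+1)] and [(k+1)/(m+1)]: the intermediate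
    points for the degree [m+1] are admissible sample points for the degree
    [m], which is the degree of the derivative. *)
Lemma node_between L m k t : 0 < L -> (k <= m)%N -> (0 < m)%N ->
  node L m.+1 k <= t <= node L m.+1 k.+1 ->
  `|t| <= L /\ `|t - node L m k| <= 2 * L / m%:R.
Proof.
move=> L0 km m0 /andP[tl tr]; split.
  have := @node_bound L m.+1 k L0 (leqW km) isT.
  have := @node_bound L m.+1 k.+1 L0 km isT.
  rewrite !ler_norml => /andP[? ?] /andP[? ?]; apply/andP; split; lra.
have M0 : 0 < m%:R :> R by rewrite ltr0n.
have M1 : 0 < m.+1%:R :> R by rewrite ltr0n.
have st := node_step L m k.
have km' : k%:R <= m%:R :> R by rewrite ler_nat.
have k0 : 0 <= k%:R :> R by [].
have mS : m.+1%:R = m%:R + 1 :> R by rewrite natr1.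
have kS : k.+1%:R = k%:R + 1 :> R by rewrite natr1.
have nl : node L m.+1 k <= node L m k.
  rewrite /node ler_pM2l// lerD2r ler_pdivrMr// mulrAC ler_pdivlMr// mS; nra.
have nr : node L m k <= node L m.+1 k.+1.
  rewrite /node ler_pM2l// lerD2r ler_pdivrMr// mulrAC ler_pdivlMr// mS kS; nra.
have : 2 * L / m.+1%:R <= 2 * L / m%:R.
  by rewrite ler_pdivrMr// mulrAC ler_pdivlMr// mS; nra.
rewrite ler_norml; move: tl tr st nl nr.
move: (node _ m _) (node _ _ k.+1) (node _ _ k) (2 * L / m.+1%:R) (2 * L / _).
by move=> a b c d' e' ? ? ? ? ? ?; apply/andP; split; lra.
Qed.


(** Averaging along the coordinate [i]. The derivative along another coordinate
    of the average is the average of the derivative, and along [i] itself the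
    mean value theorem turns the forward differences into values of the
    derivative; [bern_approx] applies in both cases. *)
Lemma bernstein_step i g L e : C1 g -> poly_below i g -> 0 < L -> 0 < e ->
  exists p, [/\ C1 p, poly_below i.+1 p & forall x, `|x| <= L ->
    `|p x - g x| <= e /\ forall j, `|'D_(delta_mx 0 j) (p : E -> R^o) x -
                                     'D_(delta_mx 0 j) (g : E -> R^o) x| <= e].
Proof.
move=> gC gP L0 e0.
have [m0 gA] := bern_approx i (C1_continuous gC) L0 e0.
have gDc j := @derive_along_continuous g (delta_mx 0 j) gC.
have /choice[m1 DA] j := bern_approx i (gDc j) L0 e0.
have [m m0m m1m] : exists2 m, (m0 < m)%N & forall j, (m1 j < m)%N.
  exists (m0 + \max_j m1 j).+1 => [|j]; first by rewrite ltnS leq_addr.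
  by rewrite ltnS (leq_trans (leq_bigmax j))// leq_addl.
pose h k := g \o setc i (node L m.+1 k); pose sg x := chart L (x 0 i).
have hC k : C1 (h k) by have [] := derive_setc i (node L m.+1 k) 0 0 gC.
have sgE : sg = fun x => 2^-1 + (2 * L)^-1 * x 0 i.
  by apply/funext => x; rewrite /sg /chart mulrC.
have cC : C1 (fun x => (2 * L)^-1 * x 0 i).
  by apply: C1_on_mul; [exact: openT|exact: C1_on_cst|exact: C1_on_coord openT].
have sgC : C1 sg.
  by rewrite sgE; apply: C1_on_add; [exact: openT|exact: C1_on_cst|].
have sgD x v : 'D_v (sg : E -> R^o) x = (2 * L)^-1 * v 0 i.
  rewrite sgE (derive_on_add v (C1_on_cst _) cC)//.
  rewrite (derive_on_mul v (C1_on_cst _) (C1_on_coord i openT))//.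
  by rewrite !derive_cst derive_coord; ring.
exists (fun x => bern m.+1 (h^~ x) (sg x)); split.
- exact: bern_C1.
- apply: poly_below_bern => [k|]; first exact: poly_below_setc.
  rewrite sgE; apply: poly_below_add; first exact: poly_below_cst.
  by apply: poly_below_mul; [exact: poly_below_cst|exact: poly_below_coord].
- move=> x xL; have nodeP k : (k <= m.+1)%N ->
     `|node L m.+1 k| <= L /\ `|node L m.+1 k - node L m.+1 k| <= 2 * L / m.+1%:R.
    by move=> km; rewrite node_bound// subrr normr0 divr_ge0// mulr_ge0// ltW.
  split; first by apply: gA => //; exact: leqW.
  move=> j; rewrite derive_bern// sgD.
  have [<-{j}|ji] := eqVneq i j; last first.
    rewrite !mxE (negbTE ji) andbF mulr0 mulr0 mul0r addr0.
    have <- : (fun k => 'D_(delta_mx 0 j) (g : E -> R^o) (setc i (node L m.+1 k) x)) =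
       (fun k => 'D_(delta_mx 0 j) (h k : E -> R^o) x).
      apply/funext => k; rewrite /h.
      have [_ ->] := derive_setc i (node L m.+1 k) x (delta_mx 0 j) gC.
      congr ('D__ _ _); apply/rowP => l; rewrite setcE !mxE eqxx/=.
      by case: (eqVneq l i) => // ->; rewrite (negbTE ji).
    by apply: DA => //; exact/leqW/m1m.
  have -> : (fun k => 'D_(delta_mx 0 i) (h k : E -> R^o) x) = (fun=> 0).
    apply/funext => k; rewrite /h.
    have [_ ->] := derive_setc i (node L m.+1 k) x (delta_mx 0 i) gC.
    rewrite -[RHS](derive0 (g : E -> R^o) (setc i (node L m.+1 k) x)).
    congr ('D__ _ _); apply/rowP => l; rewrite setcE !mxE eqxx/=.
    by case: (eqVneq l i).
  rewrite bern_cst add0r !mxE !eqxx mulr1 -bernZ /=.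
  have /choice[xi xiP] k : exists t : R, node L m.+1 k <= t <= node L m.+1 k.+1 /\
     h k.+1 x - h k x = 'D_(delta_mx 0 i) (g : E -> R^o) (setc i t x) *
       (2 * L / m.+1%:R).
    have nn : node L m.+1 k <= node L m.+1 k.+1.
      by rewrite -subr_ge0 node_step divr_ge0// mulr_ge0// ltW.
    have gd t := is_derive_setc i x t gC.
    have [] := MVT_segment nn (fun t _ => gd t).
      apply: continuous_subspaceT => t; apply: differentiable_continuous.
      by apply/derivable1_diffP; have [] := gd t.
    by move=> t; rewrite in_itv/= node_step => tn ht; exists t.
  have -> : (fun k => m.+1%:R * (2 * L)^-1 * (h k.+1 x - h k x)) =
    (fun k => 'D_(delta_mx 0 i) (g : E -> R^o) (setc i (xi k) x)).
    apply/funext => k; have [_ ->] := xiP k.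
    by field; rewrite !lt0r_neq0.
  apply: (DA i m) => // k km; apply: node_between => //.
    exact: leq_ltn_trans m0m.
  by have [] := xiP k.
Qed.

(** Each coordinate is averaged in turn. The intermediate functions are of
    class C1 on the whole space, so the next average can be compared with them
    rather than with [g]. *)
Lemma C1_weierstrass g L e : C1 g -> 0 < L -> 0 < e ->
  exists p, poly_below n p /\ forall x, `|x| <= L ->
    `|p x - g x| <= e /\ forall j, `|'D_(delta_mx 0 j) (p : E -> R^o) x -
                                     'D_(delta_mx 0 j) (g : E -> R^o) x| <= e.
Proof.
move=> gC L0 e0.
suff /(_ n (leqnn n) _ e0) [p [_ pP pA]] : forall d, (d <= n)%N -> forall e, 0 < e ->
  exists p, [/\ C1 p, poly_below d p & forall x, `|x| <= L ->
    `|p x - g x| <= e /\ forall j, `|'D_(delta_mx 0 j) (p : E -> R^o) x -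
                                     'D_(delta_mx 0 j) (g : E -> R^o) x| <= e].
  by exists p.
elim=> [_|d IH dn] {}e {}e0.
  exists g; split => //.
    by apply: poly_below_free => x y xy; congr g; apply/rowP => j; exact: xy.
  by move=> x _; split=> [|j]; rewrite subrr normr0 ltW.
have e20 : 0 < e / 2 by rewrite divr_gt0.
have [q [qC qP qA]] := IH (ltnW dn) _ e20.
have [p [pC pP pA]] := @bernstein_step (Ordinal dn) q L _ qC qP L0 e20.
exists p; split => // x xL; have [qx Dqx] := qA _ xL; have [px Dpx] := pA _ xL.
have near_trans (a b c : R) : `|a - b| <= e / 2 -> `|b - c| <= e / 2 ->
    `|a - c| <= e.
  move=> ab bc; rewrite (splitr e) -(subrK b a) -addrA.
  by rewrite (le_trans (ler_normD _ _))// lerD.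
by split=> [|j]; [exact: near_trans px qx|exact: near_trans (Dpx j) (Dqx j)].
Qed.

End C1_weierstrass.

(** * Polynomial functions *)

Section polynomials.
Context {R : realType} {n : nat}.
Local Notation E := 'rV[R]_n.
Local Notation C1 := (@C1_on R n R^o setT).
Implicit Types (g h p : E -> R) (x y v : E) (i j : 'I_n) (d m k : nat) (L e : R).

Lemma polynomial_ind (P : (E -> R) -> Prop) :
  (forall i, P (fun x => x 0 i)) -> (forall a : R, P (fun=> a)) ->
  (forall g h, P g -> P h -> P (fun x => g x + h x)) ->
  (forall g h, P g -> P h -> P (fun x => g x * h x)) ->
  forall p, poly_below n p -> P p.
Proof.
move=> Pcoord Pcst PD PM p; elim=> [j _|h hfree|g h _ Pg _ Ph|g h _ Pg _ Ph].
- exact: Pcoord.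
- suff -> : h = fun=> h 0 by [].
  by apply/funext => x; apply: hfree => j; rewrite leqNgt ltn_ord.
- exact: PD.
- exact: PM.
Qed.

Lemma polynomial_C1 p : poly_below n p -> C1 p.
Proof.
elim/polynomial_ind => [i|a|g h gC hC|g h gC hC].
- exact: C1_on_coord openT.
- exact: C1_on_cst.
- exact: (C1_on_add openT gC hC).
- exact: (C1_on_mul openT gC hC).
Qed.

Section polynomial_as_mpoly.
Import -(notations) mpoly.

Lemma polynomial_meval p : poly_below n p ->
  exists P : mpoly.mpoly n R, forall x, p x = mpoly.meval (fun i => x 0 i) P.
Proof.
elim/polynomial_ind => [i|a|g h [P gP] [Q hQ]|g h [P gP] [Q hQ]].
- by exists (mpoly.mpolyX R (mpoly.mnm1 i)) => x; rewrite mpoly.mevalXU.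
- by exists (mpoly.mpolyC n a) => x; rewrite mpoly.mevalC.
- by exists (P + Q) => x; rewrite mpoly.mevalD gP hQ.
- by exists (P * Q) => x; rewrite mpoly.mevalM gP hQ.
Qed.

End polynomial_as_mpoly.

(** Measuring growth with powers of [|x| / s >= 2] absorbs every constant into
    the exponent. *)
Lemma polynomial_growth p s : 1 <= s -> poly_below n p ->
  exists d, forall x, 2 * s <= `|x| -> `|p x| <= (`|x| / s) ^+ d.
Proof.
move=> s1; have s0 : 0 < s by apply: lt_le_trans s1.
have pow2 (a : R) : exists d, forall u : R, 2 <= u -> a <= u ^+ d.
  exists (Num.bound `|a|) => u u2; apply: (@le_trans _ _ (2 ^+ Num.bound `|a|)).
    rewrite (le_trans (ler_norm _))// (le_trans (ltW (archi_boundP _)))//.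
    by rewrite -natrX ler_nat ltnW// ltn_expl.
  by apply: lerXn2r => //; rewrite nnegrE ?ler0n//; exact: le_trans u2.
have u2 x : 2 * s <= `|x| -> 2 <= `|x| / s by rewrite ler_pdivlMr.
have u1 x : 2 * s <= `|x| -> 1 <= `|x| / s.
  by move=> /u2; apply: le_trans; rewrite ler1n.
elim/polynomial_ind => [i|a|g h [d gd] [d' hd]|g h [d gd] [d' hd]].
- have [d dP] := pow2 s; exists d.+1 => x xs.
  rewrite (le_trans (coord_le_norm _ _))// exprSr -ler_pdivrMr; last first.
    by rewrite divr_gt0// (lt_le_trans _ xs)// mulr_gt0.
  rewrite invfM mulrA divff ?div1r ?invrK; first exact/dP/u2.
  by rewrite gt_eqF// (lt_le_trans _ xs)// mulr_gt0.
- by have [d dP] := pow2 `|a|; exists d => x xs; apply/dP/u2.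
- exists (d + d').+1 => x xs; rewrite (le_trans (ler_normD _ _))//.
  have gx : `|g x| <= (`|x| / s) ^+ (d + d').
    by rewrite (le_trans (gd _ xs))// ler_weXn2l ?u1// leq_addr.
  have hx : `|h x| <= (`|x| / s) ^+ (d + d').
    by rewrite (le_trans (hd _ xs))// ler_weXn2l ?u1// leq_addl.
  rewrite exprS (le_trans (lerD gx hx))// -mulr2n -mulr_natl ler_wpM2r ?u2//.
  by rewrite exprn_ge0// (le_trans _ (u1 _ xs)).
- exists (d + d')%N => x xs; rewrite normrM exprD ler_pM//; [exact: gd|exact: hd].
Qed.

End polynomials.

(** * Cutoff functions *)

Section cutoff.
Context {R : realType} {n : nat}.
Local Notation E := 'rV[R]_n.
Local Notation C1 := (@C1_on R n R^o setT).
Implicit Types (g h : E -> R) (x y v a : E) (i j : 'I_n) (t r e : R).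

(** The square of the positive part: of class C1, and zero on the negative
    half-line. *)
Definition sqpos t : R := Num.max t 0 ^+ 2.

Lemma sqpos_ge0 t : 0 <= sqpos t. Proof. exact: sqr_ge0. Qed.

Lemma sqpos_gt0 t : 0 < t -> 0 < sqpos t.
Proof. by move=> t0; rewrite /sqpos max_l ?exprn_gt0// ltW. Qed.

Lemma sqpos_eq0 t : t <= 0 -> sqpos t = 0.
Proof. by move=> t0; rewrite /sqpos max_r// expr0n. Qed.

Lemma sqpos_is_derive t : is_derive t 1 (sqpos : R -> R^o) (2 * Num.max t 0).
Proof.
have [t0|t0|->] := ltgtP t 0.
- rewrite mulr0.
  apply: (near_eq_is_derive (f := cst 0)).
  have : \near t, t < 0 by exact: lt_nbhsl.
  by apply: filterS => s s0; rewrite sqpos_eq0// ltW.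
- have sq : is_derive t 1 (fun s : R => s ^+ 2 : R^o) (2 * t).
    by apply: is_derive_eq; rewrite /GRing.scale/=; ring.
  apply: near_eq_is_derive sq.
  have : \near t, 0 < t by exact: lt_nbhsr.
  by apply: filterS => s s0; rewrite /sqpos max_l// ltW.
- rewrite mulr0.
  have D0 : (fun h : R =>
      h^-1 *: ((sqpos \o shift 0) (h *: 1) - sqpos 0 : R^o)) @ 0^' --> (0 : R^o).
    apply/cvgrPdist_le => e e0; near=> s.
    have s0 : s != 0 by near: s; exact: nbhs_dnbhs_neq.
    rewrite sub0r normrN /= addr0 [sqpos 0]sqpos_eq0// subr0 normrM normrV ?unitfE//.
    rewrite ler_pdivrMl ?normr_gt0// /GRing.scale/= mulr1.
    have se : `|s| <= e by near: s; apply: dnbhs0_le.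
    apply: (@le_trans _ _ (`|s| * `|s|)); last by rewrite ler_wpM2l.
    rewrite ger0_norm ?sqpos_ge0// -expr2 real_normK ?num_real// /sqpos.
    by have [s1|s1] := leP s 0; rewrite ?expr0n ?sqr_ge0.
  split; first by apply/cvg_ex; exists 0.
  exact: cvg_lim D0.
Unshelve. all: by end_near. Qed.

Lemma sqpos_derive_continuous : continuous (fun t : R => 2 * Num.max t 0).
Proof.
move=> t; apply: cvgM; first exact: cvg_cst.
by apply: (@continuous_max _ _ id (cst 0)); [exact: cvg_id|exact: cvg_cst].
Qed.

Lemma C1_sqpos g : C1 g -> C1 (fun x => sqpos (g x)).
Proof.
move=> gC; apply: (C1_on_comp openT gC (fun x _ => sqpos_is_derive (g x))).
by move=> x _; exact: sqpos_derive_continuous.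
Qed.

Lemma derive_sqpos g x v : C1 g ->
  'D_v (fun y => sqpos (g y) : R^o) x = 2 * Num.max (g x) 0 * 'D_v (g : E -> R^o) x.
Proof.
by move=> gC; have [_ ->] := derive_on_comp v gC I (sqpos_is_derive (g x)).
Qed.

Lemma bump a r : 0 < r -> exists b, [/\ C1 b, forall x, 0 <= b x,
  forall x, ball a r x -> 0 < b x & forall x, r < `|a - x| -> b x = 0].
Proof.
move=> r0.
pose q i x := r ^+ 2 + (-1) * ((x 0 i + - a 0 i) * (x 0 i + - a 0 i)).
exists (fun x => \prod_i sqpos (q i x)); split.
- apply: C1_on_prod => [|i]; first exact: openT.
  apply: C1_sqpos; apply: C1_on_add => //; try exact: openT; try exact: C1_on_cst.
  apply: C1_on_mul => //; try exact: openT; try exact: C1_on_cst.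
  have xa : C1 (fun x => x 0 i + - a 0 i).
    by apply: C1_on_add; [exact: openT|exact: C1_on_coord openT|exact: C1_on_cst].
  exact: (C1_on_mul openT xa xa).
- by move=> x; apply: prodr_ge0 => i _; exact: sqpos_ge0.
- move=> x; rewrite -ball_normE /= => ax; apply: prodr_gt0 => i _.
  apply: sqpos_gt0; rewrite /q.
  have : `|(a - x) 0 i| < r by apply: le_lt_trans ax; exact: coord_le_norm.
  rewrite !mxE ltr_norml => /andP[? ?]; nra.
- move=> x rax; apply/eqP/prodf_eq0.
  have [//|ni] := pselect (exists2 i, true & sqpos (q i x) == 0).
  exfalso; move: rax; rewrite ltNge => /negP; apply.
  apply: norm_le_coord => [|i]; first exact: ltW.
  rewrite leNgt; apply/negP => ri; apply: ni; exists i => //.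
  apply/eqP/sqpos_eq0; move: ri; rewrite !mxE ltr_normr /q => /orP[?|?]; nra.
Qed.

(** Finitely many bumps supported in [U] add up to a function [S] that is at
    least [s > 0] on [K]. Then [1 - sqpos (1 - S / s)] vanishes where [S] does,
    and where [S >= s] it is [1] with derivative zero, because [sqpos] and its
    derivative vanish at nonpositive arguments. *)
Lemma cutoff (U K : set E) : open U -> compact K -> K `<=` U ->
  exists chi, [/\ C1 chi, forall x, 0 <= chi x <= 1,
    forall x, K x -> chi x = 1 /\ forall v, 'D_v (chi : E -> R^o) x = 0 &
    forall x, ~ U x -> \near x, chi x = 0].
Proof.
move=> Uo cK KU.
have /choice[r rP] (a : E) : exists r, 0 < r /\ (K a -> forall x, `|a - x| <= r -> U x).
  have [Ka|nKa] := pselect (K a); last by exists 1.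
  have /nbhs_ballP[e /= e0 eU] : nbhs a U.
    by apply: open_nbhs_nbhs; split => //; exact: KU.
  exists (e / 2); split => [|_ x ax]; first by rewrite divr_gt0.
  apply: eU; rewrite -ball_normE /= (le_lt_trans ax)//.
  by rewrite ltr_pdivrMr// ltr_pMr// ltr1n.
have /choice[b bP] a := bump a (rP a).1.
have [A AK Kcov] : exists2 A : seq E, forall a, a \in A -> K a &
    forall x, K x -> exists2 a, a \in A & ball a (r a) x.
  have [A AK Kcov] : finite_subset_cover K (fun a => ball a (r a)) K.
    move: cK; rewrite {1}compact_cover; apply => [a _|x Kx].
      by apply: ball_open; have [] := rP a.
    by exists x => //; apply: ballxx; have [] := rP x.
  exists (finmap.enum_fset A) => [a /AK|x /Kcov[a aA ax]]; first by rewrite inE.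
  by exists a.
pose S x := \sum_(a <- A) b a x.
have SC : C1 S by apply: C1_on_sum => [|a]; [exact: openT|case: (bP a)].
have S0 x : 0 <= S x by apply: sumr_ge0 => a _; case: (bP a).
have SK x : K x -> 0 < S x.
  move=> /Kcov[a aA xa]; rewrite /S (big_rem a)//=.
  have [_ b0 bx _] := bP a; rewrite ltr_pwDl//; first exact: bx.
  by apply: sumr_ge0 => c _; case: (bP c).
have [s s0 sS] : exists2 s, 0 < s & forall x, K x -> s <= S x.
  have [K0|K0] := pselect (K !=set0); last by exists 1 => // x Kx; case: K0; exists x.
  have Sc : {within K, continuous S}.
    by apply: continuous_subspaceT; exact: C1_continuous SC.
  have [c cK' cmin] := compact_EVT_min K0 cK Sc.
  exists (S c); first by apply: SK; rewrite inE in cK'.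
  by move=> x Kx; apply: cmin; rewrite inE.
pose T x := 1 + (- s^-1) * S x.
have TC : C1 T.
  apply: C1_on_add; [exact: openT|exact: C1_on_cst|].
  by apply: C1_on_mul; [exact: openT|exact: C1_on_cst|].
have T1 x : T x <= 1 by rewrite /T mulNr gerDl oppr_le0 mulr_ge0 ?invr_ge0 ?(ltW s0).
have TK x : K x -> T x <= 0.
  by move=> Kx; rewrite /T mulNr subr_le0 mulrC ler_pdivlMr// mul1r sS.
have QC := C1_sqpos TC.
have C1N : C1 (fun x => -1 * sqpos (T x)).
  by apply: C1_on_mul; [exact: openT|exact: C1_on_cst|].
exists (fun x => 1 + (-1) * sqpos (T x)); split.
- by apply: C1_on_add; [exact: openT|exact: C1_on_cst|].
- move=> x; have := sqpos_ge0 (T x); have : sqpos (T x) <= 1.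
    rewrite /sqpos expr_le1 ?le_max ?lexx ?orbT//.
    by rewrite ge_max T1 ler01.
  by move=> ? ?; apply/andP; split; lra.
- move=> x Kx; split; first by rewrite sqpos_eq0 ?TK// mulr0 addr0.
  move=> v; rewrite (derive_on_add v (C1_on_cst _) C1N)//.
  rewrite (derive_on_mul v (C1_on_cst _) QC (I : setT x)).
  rewrite (derive_sqpos x v TC) !derive_cst.
  by rewrite max_r ?TK//; ring.
- move=> x nUx.
  have : \near x, forall a, a \in A -> b a x = 0.
    elim: A AK {Kcov S SC S0 SK sS T TC T1 TK QC C1N} => [|a s' IH] sK.
      by near=> y.
    have : \near x, r a < `|a - x|.
      have rax : r a < `|a - x|.
        rewrite ltNge; apply/negP => ax; apply: nUx.
        by apply: (rP a).2 ax; apply: sK; rewrite inE eqxx.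
      apply/nbhs_ballP; exists (`|a - x| - r a) => [|y] /=; first by rewrite subr_gt0.
      rewrite -ball_normE /= distrC => yx.
      have := ler_normD (a - y) (y - x); rewrite addrA subrK.
      by move: yx; lra.
    have : \near x, forall a, a \in s' -> b a x = 0.
      by apply: IH => c cs; apply: sK; rewrite inE cs orbT.
    apply: filterS2 => y bs ay c; rewrite inE => /orP[/eqP ->|]; last exact: bs.
    by have [_ _ _] := bP a; apply.
  apply: filterS => y yA; rewrite /T /S big_seq big1 ?mulr0 ?addr0//.
  by rewrite /sqpos max_l// expr1n mulr1 subrr.
Unshelve. all: by end_near. Qed.

End cutoff.

(** * Quadratic forms and extension of a metric *)

Section metric_approximation.
Context {R : realType} {n : nat}.
Local Notation E := 'rV[R]_n.
Local Notation C1 := (@C1_on R n R^o).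
Implicit Types (g h : E -> R) (x y v w : E) (i j k l : 'I_n) (t r e : R).
Implicit Types (A B : 'M[R]_n) (G : E -> 'M[R]_n).

Lemma bformE A u v : bform A u v = \sum_i \sum_j u 0 i * A i j * v 0 j.
Proof.
rewrite /bform mxE exchange_big /=; apply: eq_bigr => j _.
by rewrite mxE big_distrl /=; apply: eq_bigr => i _; rewrite mxE.
Qed.

Lemma bformDl A B u v : bform (A + B) u v = bform A u v + bform B u v.
Proof. by rewrite /bform mulmxDr mulmxDl mxE. Qed.

Lemma bformNl A u v : bform (- A) u v = - bform A u v.
Proof. by rewrite /bform mulmxN mulNmx mxE. Qed.

Lemma bformZl A a u v : bform (a *: A) u v = a * bform A u v.
Proof. by rewrite /bform -scalemxAr -scalemxAl mxE. Qed.

Lemma bform_bound A e w : (forall i j, `|A i j| <= e) ->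
  `|bform A w w| <= n%:R ^+ 2 * e * `|w| ^+ 2.
Proof.
move=> Ae; rewrite bformE.
have -> : n%:R ^+ 2 * e * `|w| ^+ 2 = \sum_(i < n) \sum_(j < n) `|w| * e * `|w|.
  rewrite !sumr_const !card_ord -mulrnA -[RHS]mulr_natl natrM; ring.
rewrite (le_trans (ler_norm_sum _ _ _))// ler_sum// => i _.
rewrite (le_trans (ler_norm_sum _ _ _))// ler_sum// => j _.
by rewrite !normrM !ler_pM ?mulr_ge0 ?coord_le_norm.
Qed.

Lemma norm_attained w : w != 0 -> exists i, `|w| = `|w 0 i|.
Proof.
rewrite -normr_eq0 => /mx_norm_neq0[[a i] /= wi]; exists i.
by rewrite -(ord1 a) -wi.
Qed.

Lemma bform1_ge w : `|w| ^+ 2 <= bform 1%:M w w.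
Proof.
have [->|w0] := eqVneq w 0; first by rewrite /bform !mul0mx mxE normr0 expr0n.
have [i ->] := norm_attained w0.
rewrite /bform mulmx1 mxE (bigD1 i)//= mxE real_normK ?num_real// -expr2 lerDl.
by apply: sumr_ge0 => j _; rewrite mxE -expr2 sqr_ge0.
Qed.

(** The form attains a positive minimum over the product of [K] with the unit
    sphere. *)
Lemma compact_posdef (K : set E) G : compact K ->
  (forall i j, continuous (fun x => G x i j)) -> (forall x, K x -> posdef_mx (G x)) ->
  exists2 m, 0 < m & forall x w, K x -> m * `|w| ^+ 2 <= bform (G x) w w.
Proof.
move=> cK Gc Gpos; pose S := [set w : E | `|w| = 1].
have cS : compact S.
  apply: bounded_closed_compact.
    by exists 1; split => [|M M1 w /= ->]; [exact: num_real | exact: ltW].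
  have -> : S = (fun w : E => `|w|) @^-1` [set 1] by [].
  by apply: preimage_closed; [by move=> w _; exact: norm_continuous | exact: closed_eq].
have scale w : w != 0 -> S (`|w|^-1 *: w).
  move=> w0; rewrite /S /= normrZ gtr0_norm ?invr_gt0 ?normr_gt0//.
  by rewrite mulVf// normr_eq0.
have bform0 A : bform A 0 0 = 0 by rewrite /bform !mul0mx mxE.
have [KS0|KS0] := pselect (K `*` S !=set0); last first.
  exists 1 => // x w Kx; have [->|/scale Sw] := eqVneq w 0.
    by rewrite bform0 normr0 expr0n mulr0.
  by exfalso; apply: KS0; exists (x, `|w|^-1 *: w).
have Fc : continuous (fun z : E * E => bform (G z.1) z.2 z.2).
  move=> z; under eq_fun do rewrite bformE.
  have addc : continuous (fun z : R^o * R^o => z.1 + z.2).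
    by move=> ?; apply: cvgD; [exact: cvg_fst | exact: cvg_snd].
  have coordc i : (fun z : E * E => z.2 0 i) @ z --> z.2 0 i.
    by apply: (@continuous_comp _ _ _ snd (fun w : E => w 0 i));
      [exact: cvg_snd|exact: coord_continuous].
  apply: (cvg_big addc (F := nbhs z)) => i _.
  apply: (cvg_big addc (F := nbhs z)) => j _.
  apply: cvgM; last exact: coordc.
  apply: cvgM; first exact: coordc.
  by apply: (@continuous_comp _ _ _ fst (fun x : E => G x i j));
      [exact: cvg_fst|exact: Gc].
have [[a b] + cmin] := compact_EVT_min KS0 (compact_setX cK cS)
  (continuous_subspaceT Fc).
rewrite inE => -[/= Ka Sb]; exists (bform (G a) b b).
  by apply: Gpos => //; apply: contraPneq Sb => -> /eqP; rewrite normr0 eq_sym oner_eq0.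
move=> x w Kx; have [->|w0] := eqVneq w 0; first by rewrite bform0 normr0 expr0n mulr0.
have := cmin (x, `|w|^-1 *: w); rewrite inE /= => /(_ (conj Kx (scale _ w0))).
by rewrite bformZ exprVn mulrC ler_pdivlMr// exprn_gt0// normr_gt0.
Qed.

(** The extension is [chi (G - 1) + 1] for a cutoff [chi]: a convex combination
    of two positive definite matrices on [U], and the identity near every
    point outside [U]. *)
Lemma metric_extension (U K : set E) G : open U -> compact K -> K `<=` U ->
  riemannian_metric U G -> exists H : E -> 'M[R]_n,
  [/\ forall k l, C1 setT (fun x => H x k l),
      forall x, symmetric_mx (H x) /\ posdef_mx (H x) &
      forall x, K x -> forall k l, H x k l = G x k l /\
        forall v, 'D_v (fun y => H y k l : R^o) x = 'D_v (fun y => G y k l : R^o) x].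
Proof.
move=> Uo cK KU [GC Gpos]; have [chi [chiC chi01 chiK chiU]] := cutoff Uo cK KU.
pose H x := chi x *: (G x - 1%:M) + 1%:M; exists H.
have HE k l : (fun x => H x k l) =
    (fun x => chi x * (G x k l + (- (k == l)%:R)) + (k == l)%:R).
  by apply/funext => x; rewrite !mxE.
have gC k l : C1 U (fun x => G x k l) by move/(C1_on_mxP _ Uo) : GC; apply.
have chiCU : C1 U chi by apply: C1_onS chiC.
have gdC k l : C1 U (fun x => G x k l + (- (k == l)%:R)).
  exact: (C1_on_add Uo (gC k l) (C1_on_cst _)).
have cC k l := C1_on_mul Uo chiCU (gdC k l).
split.
- move=> k l; rewrite HE => x _; have [Ux|nUx] := pselect (U x).
    exact: (C1_on_add Uo (cC k l) (C1_on_cst _)).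
  apply: (@C1_on_near _ _ [set x] (fun=> (k == l)%:R)) => //; last exact: C1_on_cst.
  by move=> _ ->; apply: filterS (chiU _ nUx) => y ->; rewrite mul0r add0r.
- move=> x; have [Ux|nUx] := pselect (U x); last first.
    have -> : H x = 1%:M.
      by rewrite /H (nbhs_singleton (chiU _ nUx)) scale0r add0r.
    by split; [exact: trmx1|exact: posdef_mx1].
  have [Gs Gp] := Gpos _ Ux; split.
    by rewrite /symmetric_mx /H linearD linearZ linearB /= Gs trmx1.
  move=> w w0; rewrite /H bformDl bformZl bformDl bformNl.
  have := Gp _ w0; have := posdef_mx1 w0; have /andP[] := chi01 x.
  move: (chi x) (bform (G x) w w) (bform 1%:M w w) => c a b c0 c1 b0 a0.
  have [->|cn] := eqVneq c 0; first by lra.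
  have cp : 0 < c by rewrite lt_def cn.
  have := mulr_gt0 cp a0; nra.
- move=> x Kx k l; have Ux := KU _ Kx; have [chi1 dchi] := chiK _ Kx.
  have -> : H x k l = G x k l by rewrite /H chi1 scale1r subrK.
  split=> // v; rewrite HE (derive_on_add v (cC k l) (C1_on_cst _) Ux).
  rewrite (derive_on_mul v chiCU (gdC k l) Ux) chi1 dchi.
  rewrite (derive_on_add v (gC k l) (C1_on_cst _) Ux) !derive_cst.
  by rewrite mul1r mulr0 !addr0.
Qed.

End metric_approximation.

(** * Sums of even powers *)

Section polynomial_metric.
Context {R : realType} {n : nat}.
Local Notation E := 'rV[R]_n.
Local Notation C1 := (@C1_on R n R^o).
Implicit Types (g h : E -> R) (x y v w : E) (i j k l : 'I_n) (s e : R) (N : nat).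
Implicit Types (G : E -> 'M[R]_n).

Definition power_sum s N x : R := \sum_i (s^-1 * x 0 i) ^+ N.

Lemma poly_below_exp d g N : poly_below d g -> poly_below d (fun x => g x ^+ N).
Proof.
move=> gP; elim: N => [|N IH].
  by under eq_fun do rewrite expr0; exact: poly_below_cst.
by under eq_fun do rewrite exprS; exact: poly_below_mul.
Qed.

Lemma poly_below_sum d (I : Type) (r : seq I) (F : I -> E -> R) :
  (forall t, poly_below d (F t)) -> poly_below d (fun x => \sum_(t <- r) F t x).
Proof.
move=> FP; elim: r => [|t r IH].
  by under eq_fun do rewrite big_nil; exact: poly_below_cst.
by under eq_fun do rewrite big_cons; exact: poly_below_add.
Qed.

Lemma power_sum_polynomial s N : poly_below n (power_sum s N).
Proof.
apply: poly_below_sum => i; apply: poly_below_exp; apply: poly_below_mul.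
  exact: poly_below_cst.
exact: poly_below_coord.
Qed.

Lemma derive_power_sum s N x v : 'D_v (power_sum s N : E -> R^o) x =
  \sum_i N%:R * (s^-1 * x 0 i) ^+ N.-1 * (s^-1 * v 0 i).
Proof.
have cP i : poly_below n (fun x : E => s^-1 * x 0 i).
  by apply: poly_below_mul; [exact: poly_below_cst|exact: poly_below_coord].
have cC i : C1 setT (fun x => s^-1 * x 0 i) := polynomial_C1 (cP i).
have cXC i : C1 setT (fun x => (s^-1 * x 0 i) ^+ N) :=
  polynomial_C1 (poly_below_exp N (cP i)).
rewrite (derive_on_sum _ _ openT cXC)//; apply: eq_bigr => i _.
have pd : is_derive (s^-1 * x 0 i) 1 (fun t : R => t ^+ N : R^o)
    (N%:R * (s^-1 * x 0 i) ^+ N.-1).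
  split; first exact: exprn_derivable.
  by rewrite exp_derive /GRing.scale/= mulr1.
have [_ ->] := derive_on_comp v (cC i) I pd.
rewrite (derive_on_mul v (C1_on_cst _) (C1_on_coord i openT))//.
by rewrite derive_cst derive_coord mulr0 addr0.
Qed.

Lemma power_sum_ge s N x : 0 < s -> ~~ odd N -> x != 0 ->
  (`|x| / s) ^+ N <= power_sum s N x.
Proof.
move=> s0 Ne x0; have [i xi] := norm_attained x0.
have Fge j : 0 <= (s^-1 * x 0 j) ^+ N by rewrite exprn_even_ge0.
rewrite /power_sum (bigD1 i)//= xi mulrC -[s^-1 in leLHS]gtr0_norm ?invr_gt0//.
by rewrite -normrM -normrX ger0_norm// lerDl sumr_ge0.
Qed.

Lemma power_sum_ge0 s N x : ~~ odd N -> 0 <= power_sum s N x.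
Proof. by move=> Ne; apply: sumr_ge0 => i _; rewrite exprn_even_ge0. Qed.

(** The bound is [4 n N / 4 ^ N], the larger of the two estimates, and it tends
    to zero because [N <= 2 ^ N]. *)
Lemma power_sum_small s e : 1 <= s -> 0 < e -> exists N0, forall N, (N0 <= N)%N ->
  forall x, `|x| <= s / 2 -> `|power_sum s N.*2 x| <= e /\
    forall j, `|'D_(delta_mx 0 j) (power_sum s N.*2 : E -> R^o) x| <= e.
Proof.
move=> s1 e0; have s0 : 0 < s by apply: lt_le_trans s1.
exists (Num.bound (4 * n%:R / e)).+1 => N NN x xs.
have [M NM] : exists M, N = M.+1 by case: N NN => // M; exists M.
have c i : `|s^-1 * x 0 i| <= 2^-1.
  rewrite normrM gtr0_norm ?invr_gt0// ler_pdivrMl// (le_trans (coord_le_norm _ _))//.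
have small : n%:R * (N.*2%:R * 2^-1 ^+ N.*2.-1) <= e.
  have NP : N%:R <= 2 ^+ N :> R by rewrite -natrX ler_nat ltnW// ltn_expl.
  have bN : 4 * n%:R / e <= N%:R.
    apply: le_trans (ltW (archi_boundP _)) _; first by rewrite divr_ge0// ltW.
    by rewrite ler_nat ltnW.
  rewrite ler_pdivrMr// in bN.
  have -> : n%:R * (N.*2%:R * 2^-1 ^+ N.*2.-1) =
      4 * n%:R * N%:R / (2 ^+ N * 2 ^+ N) :> R.
    rewrite NM doubleS /= exprS -addnn exprD exprVn exprS.
    rewrite -!natr1 natrD; field.
    by rewrite expf_neq0.
  rewrite ler_pdivrMr ?mulr_gt0 ?exprn_gt0//.
  apply: (@le_trans _ _ (N%:R * e * N%:R)); first by rewrite ler_wpM2r.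
  by rewrite mulrAC mulrC ler_wpM2l ?(ltW e0)// ler_pM.
have sumc (a : R) : n%:R * a = \sum_(i < n) a.
  by rewrite sumr_const card_ord mulr_natl.
split=> [|j].
- apply: le_trans small; rewrite (le_trans (ler_norm_sum _ _ _))//.
  rewrite sumc; apply: ler_sum => i _.
  rewrite normrX NM doubleS/= exprS ler_pM//.
    by rewrite (le_trans (c i))// (@le_trans _ _ 1) ?invf_le1 ?ler1n.
  by rewrite lerXn2r ?nnegrE ?c.
- apply: le_trans small; rewrite derive_power_sum (le_trans (ler_norm_sum _ _ _))//.
  rewrite sumc; apply: ler_sum => i _.
  rewrite !normrM normr_nat normrX -[leRHS]mulr1.
  apply: ler_pM => //; rewrite ?mulr_ge0//.
    by rewrite ler_wpM2l// lerXn2r ?nnegrE ?c.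
  rewrite gtr0_norm ?invr_gt0// mxE eqxx/=.
  by case: (i == j); rewrite ?normr1 ?normr0 ?mulr1 ?mulr0 ?invf_le1.
Qed.

End polynomial_metric.

(** * Polynomial metrics *)

Section polynomial_metric_approximation.
Context {R : realType} {n : nat}.
Local Notation E := 'rV[R]_n.
Local Notation C1 := (@C1_on R n R^o).
Implicit Types (x y v w : E) (i j k l : 'I_n) (s e : R) (d N : nat).

(** For [u >= 2] the constant [n ^ 2] costs at most [n ^ 2 + 1] in the
    exponent. *)
Lemma growth_gap (u : R) d N : 2 <= u -> (d + (n ^ 2).+1 <= N)%N ->
  n%:R ^+ 2 * u ^+ d < u ^+ N.
Proof.
move=> u2 dN; have u1 : 1 <= u by apply: le_trans u2; rewrite ler1n.
apply: lt_le_trans (ler_weXn2l u1 dN); rewrite exprD mulrC ltr_pM2l; last first.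
  by rewrite exprn_gt0// (lt_le_trans _ u1).
apply: (@lt_le_trans _ _ (2 ^+ (n ^ 2).+1)).
  by rewrite -!natrX ltr_nat (ltn_trans _ (ltn_expl _ _))// ltnS.
by apply: lerXn2r => //; rewrite nnegrE ?ler0n// (le_trans _ u1).
Qed.

(** The approximation [Q] of the extended metric [H] is positive definite on
    the cube [|x| <= 2 s], which contains [K] in its interior; the correction
    [T] takes over outside the cube and is negligible on [K], where
    [|x| <= s / 2]. *)
Lemma polynomial_metric_approx (U K : set E) (G : E -> 'M[R]_n) e :
  open U -> compact K -> K `<=` U -> riemannian_metric U G -> 0 < e ->
  exists P, [/\ riemannian_metric U P, polynomial_entries U P &
    forall x, K x -> forall k l, `|P x k l - G x k l| <= e /\
      forall j, `|'D_(delta_mx 0 j) (fun y => P y k l : R^o) x -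
                  'D_(delta_mx 0 j) (fun y => G y k l : R^o) x| <= e].
Proof.
move=> Uo cK KU Gm e0.
have [H [HC Hpos HK]] := metric_extension Uo cK KU Gm.
have [s s1 Ks] : exists2 s, 1 <= s & forall x, K x -> `|x| <= s / 2.
  have [M M0 KM] := compact_norm_bounded cK (fun t _ => @norm_continuous _ _ t).
  exists (2 * (1 + M)) => [|x /KM]; first by lra.
  by rewrite normr_id; lra.
have s0 : 0 < s by apply: lt_le_trans s1.
have box x : `|x| <= s / 2 -> `|x| <= 2 * s by lra.
have [m m0 Hm] : exists2 m, 0 < m & forall x w, `|x| <= 2 * s ->
    m * `|w| ^+ 2 <= bform (H x) w w.
  apply: compact_posdef; first exact: compact_box.
    by move=> i j; exact: C1_continuous (HC i j).
  by move=> x _; have [] := Hpos x.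
(* the first bound is the error allowed on [K], the second one keeps [Q]
   positive definite on the cube *)
pose ep := Num.min (e / 2) (m / (2 * (n%:R ^+ 2 + 1))).
have n20 : 0 <= n%:R ^+ 2 :> R by rewrite sqr_ge0.
have ep0 : 0 < ep.
  by rewrite lt_min !divr_gt0// mulr_gt0// ltr_wpDl.
have epe : ep <= e / 2 by rewrite ge_min lexx.
have epm : n%:R ^+ 2 * ep < m.
  have : ep <= m / (2 * (n%:R ^+ 2 + 1)) by rewrite ge_min lexx orbT.
  rewrite ler_pdivlMr; last by rewrite mulr_gt0// ltr_wpDl.
  by nra.
have s20 : 0 < 2 * s by rewrite mulr_gt0.
have /choice[q qP] (kl : 'I_n * 'I_n) :=
  C1_weierstrass (HC kl.1 kl.2) s20 ep0.
(* choosing the approximation on and above the diagonal makes [Q] symmetric *)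
pose Q x : 'M[R]_n := \matrix_(k, l) q (if (k <= l)%N then (k, l) else (l, k)) x.
have QP k l : poly_below n (fun x => Q x k l).
  under eq_fun do rewrite mxE.
  exact: (qP _).1.
have QH k l x : `|x| <= 2 * s -> `|Q x k l - H x k l| <= ep /\
   forall j, `|'D_(delta_mx 0 j) (fun y => Q y k l : R^o) x -
               'D_(delta_mx 0 j) (fun y => H y k l : R^o) x| <= ep.
  move=> xs; under eq_fun do rewrite mxE.
  rewrite mxE; have [_ /(_ x xs)] := qP (if (k <= l)%N then (k, l) else (l, k)).
  case: ifP => //= _.
  have Hlk y : H y l k = H y k l by have [Hs _] := Hpos y; rewrite -[in LHS]Hs mxE.
  have HE : (fun y => H y l k) = (fun y => H y k l) by exact/funext.
  by rewrite Hlk HE.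
have Qsym x : symmetric_mx (Q x).
  apply/matrixP => k l; rewrite !mxE; case: ltngtP => // kl.
  by have -> : k = l by exact: val_inj.
have /choice[d dP] (kl : 'I_n * 'I_n) := polynomial_growth s1 (QP kl.1 kl.2).
have e20 : 0 < e / 2 by rewrite divr_gt0.
have [N0 NP] := @power_sum_small R n s (e / 2) s1 e20.
pose dm := \max_kl d kl.
(* [N0] makes [T] small on [K], and the rest makes it dominate the entries of
   [Q] outside the cube *)
pose N := (N0 + (dm + (n ^ 2).+1))%N.
pose T x := power_sum s N.*2 x.
pose P x := Q x + T x *: 1%:M.
have TP : poly_below n T by exact: power_sum_polynomial.
have PE k l : (fun x => P x k l) = (fun x => Q x k l + (k == l)%:R * T x).
  by apply/funext => x; rewrite !mxE mulrC.
have PP k l : poly_below n (fun x => P x k l).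
  rewrite PE; apply: poly_below_add => //; apply: poly_below_mul => //.
  exact: poly_below_cst.
exists P; split.
- split; first by apply/(C1_on_mxP _ Uo) => k l; apply: C1_onS (polynomial_C1 (PP k l)).
  move=> x _; split; first by rewrite /symmetric_mx linearD linearZ /= Qsym trmx1.
  move=> w w0; rewrite bformDl bformZl.
  have w2 : 0 < `|w| ^+ 2 by rewrite exprn_gt0// normr_gt0.
  have w1 := bform1_ge w.
  have Ne : ~~ odd N.*2 by rewrite odd_double.
  have [xs|xs] := leP `|x| (2 * s).
    have : `|bform (Q x - H x) w w| <= n%:R ^+ 2 * ep * `|w| ^+ 2.
      by apply: bform_bound => i j; have [+ _] := QH i j x xs; rewrite !mxE.
    rewrite bformDl bformNl ler_norml => /andP[QHx _].
    have Hx := Hm x w xs; have Tx : 0 <= T x by exact: power_sum_ge0.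
    have : n%:R ^+ 2 * ep * `|w| ^+ 2 < m * `|w| ^+ 2 by rewrite ltr_pM2r.
    have : 0 <= T x * bform 1%:M w w by rewrite mulr_ge0// (le_trans (ltW w2)).
    by lra.
  have x0 : x != 0 by rewrite -normr_gt0 (lt_trans _ xs).
  pose u := `|x| / s; have u2 : 2 <= u by rewrite ler_pdivlMr// ltW.
  have u1 : 1 <= u by apply: le_trans u2; rewrite ler1n.
  have : `|bform (Q x) w w| <= n%:R ^+ 2 * u ^+ dm * `|w| ^+ 2.
    apply: bform_bound => i j; rewrite (le_trans (dP (i, j) x (ltW xs)))//.
    by rewrite ler_weXn2l// leq_bigmax.
  rewrite ler_norml => /andP[Qx _].
  have gap : n%:R ^+ 2 * u ^+ dm < T x.
    apply: lt_le_trans (power_sum_ge s0 Ne x0); apply: growth_gap => //.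
    by rewrite -addnn /N (leq_trans (leq_addl N0 _))// leq_addr.
  have T0 : 0 <= T x by exact: power_sum_ge0.
  have : T x * `|w| ^+ 2 <= T x * bform 1%:M w w by rewrite ler_wpM2l.
  have : n%:R ^+ 2 * u ^+ dm * `|w| ^+ 2 < T x * `|w| ^+ 2 by rewrite ltr_pM2r.
  by lra.
- have /choice[p pP] (kl : 'I_n * 'I_n) := polynomial_meval (PP kl.1 kl.2).
  by exists (fun k l => p (k, l)) => x _ k l; exact: (pP (k, l) x).
- move=> x Kx k l; have xs := Ks _ Kx.
  have [Tx DTx] := NP N (leq_addr _ _) x xs.
  have [Qx DQx] := QH k l x (box _ xs).
  have [HG DHG] := HK x Kx k l.
  have del (t : R) : `|t| <= e / 2 -> `|(k == l)%:R * t| <= e / 2.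
    by case: (k == l); rewrite ?mul1r// mul0r normr0 => _; exact: ltW.
  split=> [|j].
    have -> : P x k l = Q x k l + (k == l)%:R * T x by rewrite !mxE mulrC.
    rewrite -HG addrAC (splitr e) (le_trans (ler_normD _ _))//.
    by rewrite lerD ?del// (le_trans Qx).
  have dTP := poly_below_mul (poly_below_cst n (k == l)%:R) TP.
  rewrite PE (derive_on_add _ (polynomial_C1 (QP k l)) (polynomial_C1 dTP))//.
  rewrite (derive_on_mul _ (C1_on_cst _) (polynomial_C1 TP))// derive_cst mulr0 addr0.
  rewrite -DHG addrAC (splitr e) (le_trans (ler_normD _ _))//.
  by rewrite lerD ?del ?DTx// (le_trans (DQx j)).
Qed.

End polynomial_metric_approximation.

(** * The inverse metric *)

Section inverse_metric.
Context {R : realType} {n : nat}.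
Local Notation E := 'rV[R]_n.
Local Notation C1 := (@C1_on R n R^o).
Implicit Types (U K : set E) (x y v w : E) (i j k l : 'I_n) (c e : R).
Implicit Types (G : E -> 'M[R]_n) (f : E -> E) (A B : 'M[R]_n).

Lemma C1_on_det U m (A : E -> 'M[R]_m) : open U ->
  (forall a b, C1 U (fun x => A x a b)) -> C1 U (fun x => \det (A x)).
Proof.
move=> Uo AC; apply: C1_on_sum => // s; apply: C1_on_mul => //.
  exact: C1_on_cst.
exact: C1_on_prod.
Qed.

Lemma posdef_unitmx A : posdef_mx A -> A \in unitmx.
Proof.
move=> Apos; rewrite unitmxE unitfE; apply/eqP => /eqP/det0P[v v0 vA].
by have := Apos _ v0; rewrite /bform vA mul0mx mxE ltxx.
Qed.

Lemma bform_congr A B v : bform (B *m A *m B^T) v v = bform A (v *m B) (v *m B).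
Proof. by rewrite /bform trmx_mul !mulmxA. Qed.

(** By Cramer's rule the entries of the inverse are quotients of polynomials in
    the entries of [G]. *)
Lemma inverse_metric U G : open U -> riemannian_metric U G ->
  riemannian_metric U (fun x => invmx (G x)).
Proof.
move=> Uo [/(C1_on_mxP _ Uo) GC Gpos]; split.
  apply/(C1_on_mxP _ Uo) => k l.
  have adjC : C1 U (fun x => (\det (G x))^-1 * \adj (G x) k l).
    apply: C1_on_mul => //.
      apply: C1_on_inv => //; first exact: C1_on_det.
      by move=> x /Gpos[_ /posdef_unitmx]; rewrite unitmxE unitfE.
    under eq_fun do rewrite mxE /cofactor.
    apply: C1_on_mul => //; first exact: C1_on_cst.
    apply: C1_on_det => // i j; under eq_fun do rewrite !mxE.
    exact: GC.
  apply: C1_on_near adjC => x Ux.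
  have : \near x, U x by apply: open_nbhs_nbhs.
  by apply: filterS => y /Gpos[_ /posdef_unitmx Gu]; rewrite /invmx Gu [RHS]mxE.
move=> x /Gpos[Gs Gp]; have Gu := posdef_unitmx Gp.
have Hs : symmetric_mx (invmx (G x)) by rewrite /symmetric_mx trmx_inv Gs.
split=> // w w0.
have -> : invmx (G x) = invmx (G x) *m G x *m (invmx (G x))^T.
  by rewrite Hs mulVmx// mul1mx.
rewrite bform_congr; apply: Gp; apply: contra_neq w0 => wG.
by rewrite -[w]mulmx1 -(mulVmx Gu) mulmxA wG mul0mx.
Qed.

(** This is the derivative of the identity [G H = 1], solved for that of [H]. *)
Lemma derive_inverse_metric U G x v : open U -> riemannian_metric U G -> U x ->
  \matrix_(k, l) 'D_v (fun y => invmx (G y) k l : R^o) x =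
  - (invmx (G x) *m (\matrix_(k, l) 'D_v (fun y => G y k l : R^o) x) *m invmx (G x)).
Proof.
move=> Uo Gm Ux; have [/(C1_on_mxP _ Uo) GC Gpos] := Gm.
have [/(C1_on_mxP _ Uo) HC _] := inverse_metric Uo Gm.
have unitG y : U y -> G y \in unitmx by move=> /Gpos[_ /posdef_unitmx].
set DH := (X in X = _); set DG := (X in _ *m X *m _).
suff GDH : G x *m DH = - (DG *m invmx (G x)).
  by rewrite -[LHS](mulKmx (unitG _ Ux)) GDH mulmxN mulmxA.
apply/eqP; rewrite -addr_eq0; apply/eqP/matrixP => k l.
have cst1 : 'D_v (fun y => \sum_j G y k j * invmx (G y) j l : R^o) x = 0.
  rewrite -[RHS](derive_cst ((k == l)%:R : R^o) x v); apply: near_eq_derive.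
  have : \near x, U x by apply: open_nbhs_nbhs.
  apply: filterS => y /unitG Gu.
  by have := congr1 (fun A => A k l) (mulmxV Gu); rewrite !mxE.
rewrite !mxE -big_split /= -[RHS]cst1.
rewrite (derive_on_sum _ _ Uo (fun j => C1_on_mul Uo (GC k j) (HC j l)))//.
apply: eq_bigr => j _; rewrite (derive_on_mul _ (GC k j) (HC j l))// !mxE.
by rewrite [X in _ + X]mulrC.
Qed.

Lemma orbital_derivativeE f G x : orbital_derivative f G x =
  \sum_j f x 0 j *: \matrix_(k, l) 'D_(delta_mx 0 j) (fun y => G y k l : R^o) x.
Proof.
apply/matrixP => k l; rewrite summxE mxE.
by apply: eq_bigr => j _; rewrite !mxE.
Qed.

Lemma orbital_derivative_inverse U G f x : open U -> riemannian_metric U G -> U x ->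
  orbital_derivative f (fun y => invmx (G y)) x =
  - (invmx (G x) *m orbital_derivative f G x *m invmx (G x)).
Proof.
move=> Uo Gm Ux; rewrite !orbital_derivativeE mulmx_sumr mulmx_suml -sumrN.
apply: eq_bigr => j _.
by rewrite (derive_inverse_metric _ Uo Gm Ux) -scalemxAr -scalemxAl scalerN.
Qed.

(** The orbital derivative enters the two forms with opposite signs, because
    inversion reverses its sign. *)
Lemma dual_form U G f x v : open U -> riemannian_metric U G -> U x ->
  let H y := invmx (G y) in
  bform (Jmx f x *m H x - 2^-1 *: orbital_derivative f H x) v v =
  bform (G x *m Jmx f x + 2^-1 *: orbital_derivative f G x) (v *m H x) (v *m H x).
Proof.
move=> Uo Gm Ux H; have [_ /(_ _ Ux) [Gs Gp]] := Gm.
have Gu := posdef_unitmx Gp.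
have Hs : (H x)^T = H x by rewrite /H trmx_inv Gs.
rewrite -bform_congr Hs (orbital_derivative_inverse _ Uo Gm Ux) scalerN opprK.
rewrite mulmxDr mulmxDl mulmxA mulVmx// mul1mx.
by rewrite -scalemxAr -scalemxAl.
Qed.

End inverse_metric.

Section contraction.
Context {R : realType} {n : nat}.
Local Notation E := 'rV[R]_n.
Implicit Types (U K : set E) (x y v w : E) (i j k l : 'I_n) (c e : R).
Implicit Types (G : E -> 'M[R]_n) (f : E -> E) (A B : 'M[R]_n).

(** Rescaling removes the normalisation, and with it the case distinction for
    the empty set: with no admissible vector, or the zero vector only, the
    right-hand side holds trivially. *)
Lemma sup_le_homogeneous A B (z : 'cV[R]_n) c
    (S := [set w | bform A w w = 1 /\ (w *m z) 0 0 = 0]) : posdef_mx A ->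
  (ereal_sup [set (bform B w w)%:E | w in S] <= (- c)%:E)%E <->
  forall w, (w *m z) 0 0 = 0 -> bform B w w <= - c * bform A w w.
Proof.
move=> Ap; split=> [supB w wz|Bc].
  have [->|w0] := eqVneq w 0; first by rewrite /bform !mul0mx !mxE mulr0.
  have Aw := Ap _ w0; pose a := (Num.sqrt (bform A w w))^-1.
  have aa : a ^+ 2 = (bform A w w)^-1 by rewrite exprVn sqr_sqrtr ?ltW.
  have : ((bform B (a *: w) (a *: w))%:E <= (- c)%:E)%E.
    apply: le_trans supB; apply: ereal_sup_ubound; exists (a *: w) => //.
    by rewrite /S /= bformZ aa mulVf ?gt_eqF// -scalemxAl mxE wz mulr0.
  by rewrite lee_fin bformZ aa mulrC ler_pdivrMr.
apply: ge_ereal_sup => _ [w [Aw wz] <-]; rewrite lee_fin.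
by have := Bc w wz; rewrite Aw mulr1.
Qed.

Lemma lambda_le f G x c : posdef_mx (G x) ->
  (lambda f G x <= (- c)%:E)%E <->
  forall w, bform (G x) w (f x) = 0 ->
    bform (G x *m Jmx f x + 2^-1 *: orbital_derivative f G x) w w
      <= - c * bform (G x) w w.
Proof.
move=> Gp; have := sup_le_homogeneous
  (G x *m Jmx f x + 2^-1 *: orbital_derivative f G x) (G x *m (f x)^T) c Gp.
rewrite /lambda /bform.
have -> : [set w : E | (w *m G x *m w^T) 0 0 = 1 /\ (w *m G x *m (f x)^T) 0 0 = 0] =
   [set w | (w *m G x *m w^T) 0 0 = 1 /\ (w *m (G x *m (f x)^T)) 0 0 = 0].
  by apply/seteqP; split=> w /=; rewrite mulmxA.
by move=> ->; split=> H w; have := H w; rewrite mulmxA.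
Qed.

Lemma lambda'_le f G x c :
  (lambda' f G x <= (- c)%:E)%E <->
  forall w, (w *m (f x)^T) 0 0 = 0 ->
    bform (Jmx f x *m G x - 2^-1 *: orbital_derivative f G x) w w
      <= - c * bform 1%:M w w.
Proof.
have := sup_le_homogeneous (Jmx f x *m G x - 2^-1 *: orbital_derivative f G x)
  (f x)^T c posdef_mx1.
rewrite /lambda'.
have -> // : [set w : E | (w *m w^T) 0 0 = 1 /\ (w *m (f x)^T) 0 0 = 0] =
   [set w | bform 1%:M w w = 1 /\ (w *m (f x)^T) 0 0 = 0].
by apply/seteqP; split=> w /=; rewrite /bform mulmx1.
Qed.

Lemma bform1_le w : bform 1%:M w w <= n%:R * `|w| ^+ 2.
Proof.
rewrite /bform mulmx1 mxE mulr_natl -[X in _ *+ X]card_ord -sumr_const ler_sum// => i _.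
by rewrite mxE -expr2 -real_normK ?num_real// lerXn2r ?nnegrE ?coord_le_norm.
Qed.

Lemma compact_family_bounded (T : topologicalType) (I : finType) (K : set T)
    (h : I -> T -> R) : compact K ->
  (forall a t, K t -> {for t, continuous (h a)}) ->
  exists2 M, 0 < M & forall t, K t -> forall a, `|h a t| <= M.
Proof.
move=> cK hc.
have /choice[M MP] (i : I) : exists M, 0 < M /\ forall t, K t -> `|h i t| <= M.
  by have [M M0 hM] := compact_norm_bounded cK (hc i); exists M.
exists (1 + \sum_i M i) => [|t Kt i].
  by rewrite ltr_pwDl// sumr_ge0// => i _; have [/ltW] := MP i.
have [_ /(_ _ Kt) hi] := MP i; rewrite (le_trans hi)// (bigD1 i)//=.
rewrite addrCA lerDl addr_ge0// sumr_ge0// => j _; by have [/ltW] := MP j.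
Qed.

(** The bound [compact_posdef] asks for continuity on the whole space, and is
    applied to an extension of [G]. *)
Lemma metric_ge U K G : open U -> compact K -> K `<=` U -> riemannian_metric U G ->
  exists2 m, 0 < m & forall x w, K x -> m * bform 1%:M w w <= bform (G x) w w.
Proof.
move=> Uo cK KU Gm; have [H [HC Hpos HK]] := metric_extension Uo cK KU Gm.
have [m m0 Hm] : exists2 m, 0 < m & forall x w, K x -> m * `|w| ^+ 2 <= bform (H x) w w.
  apply: compact_posdef => //; first by move=> i j; exact: C1_continuous (HC i j).
  by move=> x _; have [] := Hpos x.
exists (m / (n%:R + 1)) => [|x w Kx]; first by rewrite divr_gt0// ltr_wpDl.
have <- : H x = G x by apply/matrixP => k l; have [] := HK x Kx k l.
apply: le_trans (Hm x w Kx); rewrite -mulrA ler_wpM2l ?(ltW m0)//.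
rewrite ler_pdivrMl ?ltr_wpDl// (le_trans (bform1_le w))// ler_wpM2r ?sqr_ge0//.
by rewrite lerDl.
Qed.

Lemma metric_le U K G : open U -> compact K -> K `<=` U -> riemannian_metric U G ->
  exists2 M, 0 < M & forall x w, K x -> bform (G x) w w <= M * bform 1%:M w w.
Proof.
move=> Uo cK KU [/(C1_on_mxP _ Uo) GC _].
have [M M0 GM] := compact_family_bounded
  (h := fun (kl : 'I_n * 'I_n) x => G x kl.1 kl.2) cK
  (fun kl x Kx => C1_on_continuous (GC kl.1 kl.2) (KU _ Kx)).
exists (n%:R ^+ 2 * M + 1) => [|x w Kx].
  by rewrite ltr_wpDl// mulr_ge0 ?sqr_ge0// ltW.
rewrite (le_trans (ler_norm _))// (le_trans (bform_bound (e := M) _ _))//.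
  by move=> i j; exact: (GM x Kx (i, j)).
apply: ler_pM => //; rewrite ?mulr_ge0 ?sqr_ge0 ?(ltW M0)//; last exact: bform1_ge.
by rewrite lerDl.
Qed.

End contraction.

(** * Equivalence of the contraction conditions *)

Section contraction_equivalences.
Context {R : realType} {n : nat} (U K : set 'rV[R]_n) (f : 'rV[R]_n -> 'rV[R]_n).
Context (openU : open U) (f_C1 : C1_on U f) (compactK : compact K) (KU : K `<=` U).
Local Notation E := 'rV[R]_n.
Implicit Types (x v w : E) (i j k l : 'I_n) (c e : R) (G : E -> 'M[R]_n).

Lemma field_bounded : exists2 M, 0 < M & forall x, K x -> forall i, `|f x 0 i| <= M.
Proof.
apply: compact_family_bounded => // i x /KU Ux.
have fc : {for x, continuous f}.
  by have [fd _] := f_C1 Ux; exact: differentiable_continuous.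
exact: (continuous_comp fc (@coord_continuous _ _ _ 0 i _)).
Qed.

Lemma jacobian_bounded : exists2 M, 0 < M &
  forall x, K x -> forall i j, `|Jmx f x i j| <= M.
Proof.
have [M M0 JM] : exists2 M, 0 < M & forall x, K x -> forall ij : 'I_n * 'I_n,
    `|Jmx f x ij.1 ij.2| <= M; last first.
  by exists M => // x Kx i j; exact: (JM x Kx (i, j)).
apply: compact_family_bounded => // -[i j] x /KU Ux /=.
have Dc : {for x, continuous (fun y => ('D_(delta_mx 0 j) f y) 0 i)}.
  have [_ /(_ (delta_mx 0 j)) fc] := f_C1 Ux.
  exact: (continuous_comp fc (@coord_continuous _ _ _ 0 i _)).
apply: near_continuous Dc.
have : \near x, U x by apply: open_nbhs_nbhs.
apply: filterS => y Uy; have [fd _] := f_C1 Uy.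
by rewrite deriveEjacobian// -rowE /Jmx !mxE.
Qed.

(** The metric is the inverse of [G], and the constant is multiplied by a
    lower bound on [K] for the ratio of its squared length to the Euclidean one. *)
Lemma contraction_to_dual c G : 0 < c -> riemannian_metric U G ->
  (forall x, K x -> (lambda f G x <= (- c)%:E)%E) ->
  exists c' H, [/\ 0 < c', riemannian_metric U H &
    forall x, K x -> (lambda' f H x <= (- c')%:E)%E].
Proof.
move=> c0 Gm Gl; pose H x := invmx (G x).
have Hm : riemannian_metric U H := inverse_metric openU Gm.
have [m m0 mH] := metric_ge openU compactK KU Hm.
exists (c * m), H; split => [||x Kx]; [by rewrite mulr_gt0| by []|].
have Ux := KU Kx; have [_ /(_ _ Ux) [Gs Gp]] := Gm.
have Gu := posdef_unitmx Gp.
have Hs : (H x)^T = H x by rewrite /H trmx_inv Gs.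
apply/lambda'_le => v vf; rewrite (dual_form f v openU Gm Ux).
have /(lambda_le _ _ Gp) Lx := Gl _ Kx.
apply: le_trans (Lx _ _) _.
  by rewrite /bform -[v *m _ *m _]mulmxA mulVmx// mulmx1.
rewrite -bform_congr Hs mulVmx// mul1mx !mulNr lerN2 -mulrA ler_wpM2l ?(ltW c0)//.
exact: mH.
Qed.

(** The given [H] is the inverse of its own inverse, so the duality of forms is
    used in the other direction; the constant is divided by an upper bound
    on [K] for the ratio of the squared [H]-length to the Euclidean one. *)
Lemma dual_to_contraction c H : 0 < c -> riemannian_metric U H ->
  (forall x, K x -> (lambda' f H x <= (- c)%:E)%E) ->
  exists c' G, [/\ 0 < c', riemannian_metric U G &
    forall x, K x -> (lambda f G x <= (- c')%:E)%E].
Proof.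
move=> c0 Hm Hl; pose G x := invmx (H x).
have Gm : riemannian_metric U G := inverse_metric openU Hm.
have HG x : invmx (G x) = H x by rewrite /G invmxK.
have HE : (fun x => invmx (G x)) = H by apply/funext.
have [M M0 MH] := metric_le openU compactK KU Hm.
exists (c / M), G; split => [||x Kx]; [by rewrite divr_gt0| by []|].
have Ux := KU Kx; have [_ /(_ _ Ux) [Gs Gp]] := Gm.
have Gu := posdef_unitmx Gp.
apply/(lambda_le _ _ Gp) => w wf.
have := dual_form f (w *m G x) openU Gm Ux.
rewrite /= HE HG -[w *m G x *m H x]mulmxA -HG mulmxV// mulmx1 HG => <-.
have /lambda'_le Lx := Hl _ Kx.
apply: le_trans (Lx _ _) _; first exact: wf.
have -> : bform (G x) w w = bform (H x) (w *m G x) (w *m G x).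
  by rewrite -bform_congr -HG mulmxV// mul1mx Gs.
rewrite !mulNr lerN2 mulrAC ler_pdivrMr// -mulrA ler_wpM2l ?(ltW c0)//.
by rewrite mulrC; exact: MH.
Qed.

(** The forms of [P] and [G] differ by at most a constant times the distance in
    class C1 of [P] from [G] on [K], and half of [c] is left when this
    distance is small enough. *)
Lemma dual_polynomial c G : 0 < c -> riemannian_metric U G ->
  (forall x, K x -> (lambda' f G x <= (- c)%:E)%E) ->
  exists c' P, [/\ 0 < c', riemannian_metric U P, polynomial_entries U P &
    forall x, K x -> (lambda' f P x <= (- c')%:E)%E].
Proof.
move=> c0 Gm Gl; have [F F0 fF] := field_bounded; have [J J0 fJ] := jacobian_bounded.
pose q := n%:R ^+ 2 * (n%:R * (J + F)) : R.
have q0 : 0 <= q by rewrite !mulr_ge0 ?addr_ge0 ?(ltW J0) ?(ltW F0).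
(* [q e] bounds the change of the form on Euclidean unit vectors; the summand
   [1] keeps the denominator positive when [q] is [0] *)
pose e := c / (2 * (q + 1)).
have e0 : 0 < e by rewrite divr_gt0// mulr_gt0// ltr_wpDl.
have [P [Pm Ppoly PG]] := polynomial_metric_approx openU compactK KU Gm e0.
exists (c / 2), P; split => // [|x Kx]; first by rewrite divr_gt0.
apply/lambda'_le => w wf; have /lambda'_le/(_ w wf) Lx := Gl _ Kx.
pose D := (Jmx f x *m P x - 2^-1 *: orbital_derivative f P x) -
          (Jmx f x *m G x - 2^-1 *: orbital_derivative f G x).
have Db : `|bform D w w| <= n%:R ^+ 2 * (n%:R * (J + F) * e) * `|w| ^+ 2.
  apply: bform_bound => k l.
  have -> : D k l = \sum_j (Jmx f x k j * (P x j l - G x j l) -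
     2^-1 * (f x 0 j * ('D_(delta_mx 0 j) (fun y => P y k l : R^o) x -
                        'D_(delta_mx 0 j) (fun y => G y k l : R^o) x))).
    rewrite /D !mxE !mulr_sumr -!sumrB.
    by apply: eq_bigr => j _; ring.
  have -> : n%:R * (J + F) * e = \sum_(j < n) (J * e + F * e).
    by rewrite sumr_const card_ord -mulrDl -mulrA mulr_natl.
  rewrite (le_trans (ler_norm_sum _ _ _))// ler_sum// => j _.
  have [PGjl _] := PG x Kx j l; have [_ DPG] := PG x Kx k l.
  rewrite (le_trans (ler_normB _ _))// !normrM lerD//.
    by apply: ler_pM => //; exact: fJ.
  rewrite gtr0_norm ?invr_gt0// -[leRHS]mul1r ler_pM ?mulr_ge0//.
    by rewrite invf_le1 ?ler1n.
  by apply: ler_pM => //; exact: fF.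
have -> : bform (Jmx f x *m P x - 2^-1 *: orbital_derivative f P x) w w =
  bform D w w + bform (Jmx f x *m G x - 2^-1 *: orbital_derivative f G x) w w.
  by rewrite -bformDl /D subrK.
have w1 := bform1_ge w.
have qe : q * e <= c / 2.
  by rewrite /e mulrA ler_pdivrMr ?mulr_gt0 ?ltr_wpDl//; nra.
have : `|bform D w w| <= c / 2 * bform 1%:M w w.
  apply: le_trans Db _; rewrite [n%:R ^+ 2 * _]mulrA -/q.
  have qe0 : 0 <= q * e by rewrite mulr_ge0// ltW.
  by apply: ler_pM.
by rewrite ler_norml => /andP[_ D1]; lra.
Qed.

End contraction_equivalences.

Unset Implicit Arguments.

Theorem proposition1 (R : realType) (n : nat) (U K : set 'rV[R]_n)
    (f : 'rV[R]_n -> 'rV[R]_n)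
    (openU : open U) (f_C1 : C1_on U f) (compactK : compact K) (KU : K `<=` U) :
  let cond1 := exists (c : R) (G : 'rV[R]_n -> 'M[R]_n),
    [/\ 0 < c, riemannian_metric U G &
        forall x, K x -> (lambda f G x <= (- c)%:E)%E] in
  let cond2 := exists (c : R) (G : 'rV[R]_n -> 'M[R]_n),
    [/\ 0 < c, riemannian_metric U G &
        forall x, K x -> (lambda' f G x <= (- c)%:E)%E] in
  let cond3 := exists (c' : R) (G : 'rV[R]_n -> 'M[R]_n),
    [/\ 0 < c', riemannian_metric U G, polynomial_entries U G &
        forall x, K x -> (lambda' f G x <= (- c')%:E)%E] in
  (cond1 <-> cond2) /\ (cond2 <-> cond3).
Proof.
move=> cond1 cond2 cond3; split; split=> -[c [G]].
- move=> [c0 Gm Gl]; exact: (contraction_to_dual openU compactK KU c0 Gm Gl).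
- move=> [c0 Gm Gl]; exact: (dual_to_contraction openU compactK KU c0 Gm Gl).
- move=> [c0 Gm Gl]; exact: (dual_polynomial openU f_C1 compactK KU c0 Gm Gl).
- by move=> [c0 Gm _ Gl]; exists c, G.
Qed.
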